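(* Let $\Bbbk$ be a field and let $G$ be a cograph. Then $$\operatorname{reg}(S/J_G) \leq \min\{s(G), \alpha(G)\},$$ where $s(G)$ is the number of maximal independent sets of $G$ and $\alpha(G)$ is the size of a largest independent set of $G$.
   Context: All graphs are finite, simple and undirected, with nonempty vertex set. A cograph (complement reducible graph) is a graph having no induced subgraph that is a path on $4$ vertices. ''Maximal'' independent set means maximal with respect to inclusion. For a graph $G$ with vertex set $[n]=\{1,\dots,n\}$ and edge set $E$, let $S=\Bbbk[x_1,\dots,x_n,y_1,\dots,y_n]$ be the standard graded polynomial ring over the field $\Bbbk$; the binomial edge ideal of $G$ is $J_G=\langle x_iy_j-y_ix_j : \{i,j\}\in E\rangle\subseteq S$. The graded Betti numbers are $\beta_{i,j}(S/J_G)=\dim_\Bbbk \operatorname{Tor}_i^S(S/J_G,\Bbbk)_j$, and the Castelnuovo--Mumford regularity is $\operatorname{reg}(S/J_G)=\max\{j-i : \beta_{i,j}(S/J_G)\neq 0\}$. *)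

(* Defs.v *)
From HB Require Import structures.
From mathcomp Require Import all_boot all_order all_algebra.
From mathcomp Require Import mpoly.

Set Implicit Arguments.
Unset Strict Implicit.
Unset Printing Implicit Defensive.

Import Order.TTheory GRing.Theory Num.Theory.
Local Open Scope ring_scope.

(* A simple graph is a symmetric irreflexive relation on its vertex type; both
   properties are hypotheses of the theorem. *)
Section Graphs.

Variables (T : finType) (e : rel T).

Definition induced_P4 (f : 'I_4 -> T) : Prop :=
  injective f /\
  forall a b : 'I_4, e (f a) (f b) = (a.+1 == b :> nat) || (b.+1 == a :> nat).

Definition cograph : Prop := ~ exists f : 'I_4 -> T, induced_P4 f.

Definition independent (A : {set T}) : bool :=
  [forall x in A, forall y in A, ~~ e x y].

Definition num_max_independent : nat :=
  #|[set A : {set T} | maxset independent A]|.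

Definition independence_number : nat :=
  \max_(A : {set T} | independent A) #|A|.

End Graphs.

Section GradedResolutions.

Variables (k : fieldType) (N : nat).
Local Notation S := {mpoly k[N]}.

(* The data of a sequence of graded free modules of finite rank
     ... -> F_1 -> F_0 -> S,    F_i = \bigoplus_l S(- gshift i l).
   Elements of F_i are row vectors, so that a map acts by v |-> v *m A; the
   map F_0 -> S/I is given by a lift to S of its values on the basis of F_0. *)
Record gseq := GSeq {
  grank  : nat -> nat;
  gshift : forall i, 'I_(grank i) -> int;
  gdiff  : forall i, 'M[S]_(grank i.+1, grank i);
  gaug   : 'cV[S]_(grank 0)
}.

(* The maps preserve degrees: the entry of the matrix at (a, b) is homogeneous
   of degree gshift a - gshift b, hence 0 when this difference is negative. *)
Definition gseq_graded (F : gseq) : Prop :=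
  (forall i (a : 'I_(grank F i.+1)) (b : 'I_(grank F i)) (m : 'X_{1..N}),
      m \in msupp (gdiff F i a b) ->
      gshift b + (mdeg m)%:Z = gshift a) /\
  (forall (a : 'I_(grank F 0)) (m : 'X_{1..N}),
      m \in msupp (gaug F a 0) -> (mdeg m)%:Z = gshift a).

Definition gseq_exact (I : S -> Prop) (F : gseq) : Prop :=
  [/\ (forall f : S, exists v : 'rV[S]_(grank F 0),
         I (f - (v *m gaug F) 0 0)),
      (forall v : 'rV[S]_(grank F 0),
         I ((v *m gaug F) 0 0) <->
         exists w : 'rV[S]_(grank F 1), v = w *m gdiff F 0)
    & (forall i (v : 'rV[S]_(grank F i.+1)),
         v *m gdiff F i = 0 <->
         exists w : 'rV[S]_(grank F i.+2), v = w *m gdiff F i.+1)].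

(* F is a graded free resolution of S/I. *)
Definition graded_free_resolution (I : S -> Prop) (F : gseq) : Prop :=
  gseq_graded F /\ gseq_exact I F.

(* F_{i+1} (x)_S k -> F_i (x)_S k, where k = S/(all variables). *)
Definition tensor_diff (F : gseq) (i : nat) : 'M[k]_(grank F i.+1, grank F i) :=
  map_mx (mcoeff 0%MM) (gdiff F i).

(* The row space is the degree j component (F_i (x)_S k)_j. *)
Definition tensor_part (F : gseq) (i : nat) (j : int) : 'M[k]_(grank F i) :=
  diag_mx (\row_l (gshift l == j)%:R).

Definition tensor_cycles (F : gseq) (i : nat) (j : int) : 'M[k]_(grank F i) :=
  match i with
  | 0 => tensor_part F 0 j
  | i'.+1 => (tensor_part F i'.+1 j :&: kermx (tensor_diff F i'))%MS
  end.

Definition tensor_boundaries (F : gseq) (i : nat) (j : int) :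
    'M[k]_(grank F i.+1, grank F i) :=
  tensor_part F i.+1 j *m tensor_diff F i.

(* dim_k H_i(F (x)_S k)_j; the boundaries are contained in the cycles as soon
   as F is a graded complex. *)
Definition tensor_homology_dim (F : gseq) (i : nat) (j : int) : nat :=
  \rank (tensor_cycles F i j) - \rank (tensor_boundaries F i j).

(* beta_{i,j}(S/I) = dim_k Tor_i^S(S/I, k)_j is equal to b. As Tor does not
   depend on the resolution, any graded free resolution of S/I may be used. *)
Definition betti (I : S -> Prop) (i : nat) (j : int) (b : nat) : Prop :=
  exists F : gseq, graded_free_resolution I F /\ tensor_homology_dim F i j = b.

(* reg(S/I) = r, that is, r is the maximum of the j - i with
   beta_{i,j}(S/I) <> 0. *)
Definition regularity (I : S -> Prop) (r : int) : Prop :=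
  (exists (i : nat) (j : int) (b : nat),
      [/\ betti I i j b, b <> 0%N & r = j - i%:Z]) /\
  (forall (i : nat) (j : int) (b : nat),
      betti I i j b -> b <> 0%N -> j - i%:Z <= r).

End GradedResolutions.

Section BinomialEdgeIdeal.

Variables (k : fieldType) (n : nat) (e : rel 'I_n).

Definition xvar (i : 'I_n) : {mpoly k[n + n]} := 'X_(lshift n i).
Definition yvar (i : 'I_n) : {mpoly k[n + n]} := 'X_(rshift n i).

Definition binomial_edge_ideal (f : {mpoly k[n + n]}) : Prop :=
  exists c : 'I_n -> 'I_n -> {mpoly k[n + n]},
    f = \sum_i \sum_(j | e i j) c i j * (xvar i * yvar j - yvar i * xvar j).

End BinomialEdgeIdeal.

(* Main.v *)
(* The ideal [J_G] is analysed through the Koszul complex of [S] on all the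
   variables: [regle I r] says that [H_i(K (x) S/I)_j = 0] for [j - i > r].

   A cograph with at least two vertices is a disjoint union or a join. For a
   join of [G1] and [G2] on [V = V1 + V2],
     [J_G = ((V1) + J_G2) /\ ((V2) + J_G1) /\ J_(K_V)],
   and the short exact sequences [0 -> S/(A /\ B) -> S/A + S/B -> S/(A + B) -> 0]
   give [reg J_G <= max (2, reg J_G1, reg J_G2)]; complete graphs have
   regularity 1 because [x_v] is a nonzerodivisor modulo [J_(K_V)] and
     [J_(K_V) + (x_v) = ((x_v, y_v) + J_(K_(V - v))) /\ (x_i : i in V)].
   Every bound is proved for [J_G + B], with [B] an arbitrary homogeneous ideal in
   the other variables, so that disjoint unions only add the two bounds. Both
   numbers [s] and [alpha] dominate the resulting recursion.

   Chasing the double complex [F (x) K] transfers the Koszul vanishing to every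
   graded free resolution [F] of [S/I]. The same chase bounds the degrees of the
   generators of the syzygies, which are therefore finitely generated by a
   dimension count; this yields a resolution of finite rank in each degree
   without Hilbert's basis theorem. *)

Require Import Defs.
From HB Require Import structures.
From mathcomp Require Import all_boot all_order all_algebra.
From mathcomp Require Import mpoly.
From mathcomp Require Import zify ring.
From Stdlib Require Import Classical ClassicalEpsilon.

Set Implicit Arguments.
Unset Strict Implicit.
Unset Printing Implicit Defensive.

Import Order.TTheory GRing.Theory Num.Theory.
Local Open Scope ring_scope.

(** * Homogeneous components and ideals of polynomials *)

Section Homogeneous.

Variables (k : fieldType) (N : nat).
Local Notation S := {mpoly k[N]}.
Implicit Types (d e : int) (f g : S).

(** Betti numbers are read off arbitrary graded free resolutions, while the induction on the graph
    only sees ideals. Koszul homology mediates: its vanishing is a solvability statement about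
    column vectors modulo [I], so long exact sequences become short chases with explicit preimages.
    All exterior degrees can share one matrix because the polynomial degree of the entries already
    measures [j - i]; the differential raises it by 1, and a connecting map costs exactly one unit
    of the bound.

    The 2 in the bound for a join comes from two nested intersections. Adding [J_(K_V)] to the
    intersection of the first two ideals gives [((V1) + J_(K_V2)) /\ ((V2) + J_(K_V1))], again an
    intersection, whose two terms have bound 1 and whose sum [(V)] has bound 0. This ideal therefore
    has bound 1, and the outer intersection raises it to 2.

    On the combinatorial side [alpha] is superadditive on disjoint unions, but [s] is multiplicative
    there, and a sum need not be below a product when a factor is 1. This obstacle shapes the
    induction hypothesis. *)

Definition homogeneous d f := forall m, m \in msupp f -> (mdeg m)%:Z = d.

Definition hcomp d f : S :=
  \sum_(m <- msupp f | (mdeg m)%:Z == d) f@_m *: 'X_[m].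

Lemma mcoeff_hcomp d f m :
  (hcomp d f)@_m = if (mdeg m)%:Z == d then f@_m else 0.
Proof.
rewrite /hcomp raddf_sum /= big_mkcond /=.
have [mf|mf] := boolP (m \in msupp f).
  rewrite (bigD1_seq m) ?msupp_uniq //= big1 ?addr0 => [|m' neq].
    by case: ifP => _ //; rewrite mcoeffZ mcoeffX eqxx mulr1.
  by case: ifP => _ //; rewrite mcoeffZ mcoeffX (negbTE neq) mulr0.
rewrite big1_seq => [|m' /andP[_ m'f]].
  by move: mf; rewrite mcoeff_msupp negbK => /eqP ->; case: ifP.
case: ifP => _ //; rewrite mcoeffZ mcoeffX; case: eqP => [eqm|]; rewrite ?mulr0 //.
by rewrite -eqm m'f in mf.
Qed.

Lemma homogP d f :
  homogeneous d f <-> forall m, (mdeg m)%:Z != d -> f@_m = 0.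
Proof.
split=> [hf m neq|hf m].
  apply/eqP; apply: contraNT neq; rewrite -mcoeff_msupp => /hf ->; exact: eqxx.
by rewrite mcoeff_msupp => neq; apply/eqP; apply: contraNT neq => /hf ->.
Qed.

Lemma homog0 d : homogeneous d 0.
Proof. by apply/homogP => m _; rewrite mcoeff0. Qed.

Lemma homogD d f g : homogeneous d f -> homogeneous d g -> homogeneous d (f + g).
Proof.
by move=> /homogP hf /homogP hg; apply/homogP => m nm; rewrite mcoeffD hf ?hg ?addr0.
Qed.

Lemma homogN d f : homogeneous d f -> homogeneous d (- f).
Proof. by move=> /homogP hf; apply/homogP => m nm; rewrite mcoeffN hf ?oppr0. Qed.

Lemma homogB d f g : homogeneous d f -> homogeneous d g -> homogeneous d (f - g).
Proof. by move=> hf hg; apply: homogD => //; apply: homogN. Qed.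

Lemma homogM d e f g : homogeneous d f -> homogeneous e g -> homogeneous (d + e) (f * g).
Proof.
move=> hf hg m /msuppM_le /allpairsP[[m1 m2] /= [/hf <- /hg <- ->]].
by rewrite mdegD PoszD.
Qed.

Lemma homogC (c : k) : homogeneous 0 (c%:MP : S).
Proof.
move=> m; rewrite msuppC; case: eqP => // _; rewrite inE => /eqP ->.
by rewrite mdeg0.
Qed.

Lemma homogX i : homogeneous 1 ('X_i : S).
Proof. by move=> m; rewrite msuppX inE => /eqP ->; rewrite mdeg1. Qed.

Lemma homog_hcomp d f : homogeneous d (hcomp d f).
Proof. by apply/homogP => m /negbTE nm; rewrite mcoeff_hcomp nm. Qed.

Lemma hcomp_id d f : homogeneous d f -> hcomp d f = f.
Proof.
move=> /homogP hf; apply/mpolyP => m; rewrite mcoeff_hcomp.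
by case: eqP => // /eqP /hf ->.
Qed.

Lemma hcompD d f g : hcomp d (f + g) = hcomp d f + hcomp d g.
Proof.
by apply/mpolyP => m; rewrite mcoeffD !mcoeff_hcomp mcoeffD; case: ifP; rewrite ?addr0.
Qed.

Lemma hcompN d f : hcomp d (- f) = - hcomp d f.
Proof.
by apply/mpolyP => m; rewrite mcoeffN !mcoeff_hcomp mcoeffN; case: ifP; rewrite ?oppr0.
Qed.

Lemma hcomp0 d : hcomp d 0 = 0.
Proof. by apply/mpolyP => m; rewrite mcoeff_hcomp mcoeff0; case: ifP. Qed.

Lemma hcomp_sum d (J : Type) (s : seq J) (P : pred J) (F : J -> S) :
  hcomp d (\sum_(j <- s | P j) F j) = \sum_(j <- s | P j) hcomp d (F j).
Proof. by apply: (big_morph _ (hcompD d) (hcomp0 d)). Qed.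

Lemma hcompMl d e g f : homogeneous d g -> hcomp (e + d) (g * f) = g * hcomp e f.
Proof.
move=> hg; rewrite -[f in LHS](subrK (hcomp e f)) mulrDr hcompD addrC.
(* What remains besides [g * hcomp e f] is the product of [g] with the part of [f] outside degree
   [e], which has no component in degree [e + d]. *)
rewrite hcomp_id; last by rewrite addrC; apply: homogM => //; apply: homog_hcomp.
rewrite [X in _ + X](_ : _ = 0) ?addr0 //; apply/mpolyP => m.
rewrite mcoeff_hcomp mcoeff0; case: eqP => // degm; apply/eqP.
apply: contraT; rewrite -mcoeff_msupp => /msuppM_le /allpairsP[[m1 m2] /= [/hg d1]].
rewrite mcoeff_msupp mcoeffB mcoeff_hcomp => + eqm; move: degm.
rewrite eqm mdegD PoszD d1 addrC => /addIr ->; by rewrite eqxx subrr eqxx.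
Qed.

Lemma homog_mcoeff0 d f : homogeneous d f -> d != 0 -> f@_0%MM = 0.
Proof. by move=> /homogP hf nz; apply: hf; rewrite mdeg0 eq_sym. Qed.

Lemma homog_neg d f : homogeneous d f -> d < 0 -> f = 0.
Proof.
move=> /homogP hf neg; apply/mpolyP => m; rewrite mcoeff0; apply: hf.
by apply: contraTneq neg => <-.
Qed.

End Homogeneous.

(** * Ideals given by generators, and setting variables to 0 *)

Section Ideals.

Variables (k : fieldType) (N : nat).
Local Notation S := {mpoly k[N]}.
Implicit Types (I J : S -> Prop) (G H : S -> Prop) (f g : S) (U V : {set 'I_N}).

Definition ideal I :=
  [/\ I 0, forall f g, I f -> I g -> I (f + g) & forall c f, I f -> I (c * f)].

Definition hideal I := ideal I /\ forall d f, I f -> I (hcomp d f).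

Lemma ideal_opp I f : ideal I -> I f -> I (- f).
Proof. by case=> _ _ IM If; rewrite -mulN1r; apply: IM. Qed.

Lemma ideal_sub I f g : ideal I -> I f -> I g -> I (f - g).
Proof. by move=> idI If Ig; case: (idI) => _ ID _; apply: ID => //; apply: ideal_opp. Qed.

Lemma ideal_add I f g : ideal I -> I f -> I g -> I (f + g).
Proof. by case=> _ ID _ If; apply: ID. Qed.

Lemma ideal_mull I c f : ideal I -> I f -> I (c * f).
Proof. by case=> _ _ IM; apply: IM. Qed.

Lemma ideal_mulr I c f : ideal I -> I f -> I (f * c).
Proof. by move=> idI If; rewrite mulrC; apply: ideal_mull. Qed.

Lemma ideal_sum I (T : Type) (s : seq T) (P : pred T) (F : T -> S) : ideal I ->
  (forall j, P j -> I (F j)) -> I (\sum_(j <- s | P j) F j).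
Proof.
move=> idI hF; elim/big_rec: _ => [|j f Pj]; first by case: idI.
by apply: ideal_add => //; apply: hF.
Qed.

(** An inductive predicate gives induction over linear combinations without index sets, and admits
    arbitrary families of generators, such as those of the extra ideal [B]. *)
Inductive idl G : S -> Prop :=
| idl0 : idl G 0
| idl_cons c g f : G g -> idl G f -> idl G (c * g + f).

Definition gU G H g := G g \/ H g.
Definition isum I J f := exists a b, [/\ I a, J b & f = a + b].
Definition iint I J f := I f /\ J f.

Lemma idl_gen G g : G g -> idl G g.
Proof. by move=> Gg; rewrite -[g]addr0 -[g]mul1r; apply: idl_cons => //; apply: idl0. Qed.

Lemma idl_ideal G : ideal (idl G).
Proof.
split=> [|f g|c f]; first exact: idl0.
  elim=> [|c g' f' Gg _ IH] Ig; first by rewrite add0r.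
  by rewrite -addrA; apply: idl_cons => //; apply: IH.
elim=> [|c' g' f' Gg _ IH]; first by rewrite mulr0; apply: idl0.
by rewrite mulrDr mulrA; apply: idl_cons.
Qed.

Lemma idl_min G I : ideal I -> (forall g, G g -> I g) -> forall f, idl G f -> I f.
Proof.
move=> idI GI f; elim=> [|c g f' /GI Ig _ If]; first by case: idI.
by apply: ideal_add => //; apply: ideal_mull.
Qed.

Lemma idl_sub G H : (forall g, G g -> idl H g) -> forall f, idl G f -> idl H f.
Proof. exact: idl_min (idl_ideal H). Qed.

Lemma idl_Ul G H f : idl G f -> idl (gU G H) f.
Proof. by apply: idl_sub => g Gg; apply: idl_gen; left. Qed.

Lemma idl_Ur G H f : idl H f -> idl (gU G H) f.
Proof. by apply: idl_sub => g Hg; apply: idl_gen; right. Qed.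

Lemma idl_Usub G H I : ideal I -> (forall g, G g -> I g) -> (forall g, H g -> I g) ->
  forall f, idl (gU G H) f -> I f.
Proof. by move=> idI GI HI; apply: idl_min => // g []; [apply: GI|apply: HI]. Qed.

Lemma isum_ideal I J : ideal I -> ideal J -> ideal (isum I J).
Proof.
move=> idI idJ; split.
- by exists 0, 0; rewrite addr0; case: idI => ? _ _; case: idJ.
- move=> _ _ [a [b [Ia Jb ->]]] [a' [b' [Ia' Jb' ->]]].
  by exists (a + a'), (b + b'); split; [exact: ideal_add|exact: ideal_add|rewrite addrACA].
- move=> c _ [a [b [Ia Jb ->]]]; exists (c * a), (c * b).
  by split; [exact: ideal_mull|exact: ideal_mull|rewrite mulrDr].
Qed.

Lemma iint_hideal I J : hideal I -> hideal J -> hideal (iint I J).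
Proof.
move=> [idI hI] [idJ hJ]; split; first split.
- by split; [case: idI|case: idJ].
- by move=> f g [? ?] [? ?]; split; apply: ideal_add.
- by move=> c f [? ?]; split; apply: ideal_mull.
- by move=> d f [? ?]; split; [apply: hI|apply: hJ].
Qed.

Lemma isum_l I J f : ideal J -> I f -> isum I J f.
Proof. by move=> [J0 _ _] If; exists f, 0; rewrite addr0. Qed.

Lemma isum_r I J f : ideal I -> J f -> isum I J f.
Proof. by move=> [I0 _ _] Jf; exists 0, f; rewrite add0r. Qed.

Lemma idl_gU G H f : idl (gU G H) f <-> isum (idl G) (idl H) f.
Proof.
split; last first.
  by move=> [a [b [Ga Hb ->]]]; apply: ideal_add (idl_ideal _) _ _; [apply: idl_Ul|apply: idl_Ur].
apply: idl_Usub => [|g Gg|g Hg]; first by apply: isum_ideal; apply: idl_ideal.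
- by apply: isum_l (idl_ideal _) _; apply: idl_gen.
- by apply: isum_r (idl_ideal _) _; apply: idl_gen.
Qed.

Definition homG G := forall g, G g -> exists d, homogeneous d g.

Lemma homG_U G H : homG G -> homG H -> homG (gU G H).
Proof. by move=> hG hH g []; [apply: hG|apply: hH]. Qed.

Lemma idl_hideal G : homG G -> hideal (idl G).
Proof.
move=> hG; split; first exact: idl_ideal.
move=> d f; elim=> [|c g f' Gg _ IH]; first by rewrite hcomp0; apply: idl0.
rewrite hcompD; apply: ideal_add (idl_ideal _) _ IH.
have [e he] := hG _ Gg.
rewrite mulrC -(subrK e d) hcompMl //.
by apply: ideal_mulr (idl_ideal _) _; apply: idl_gen.
Qed.

Lemma idl_rmorph (phi : {rmorphism S -> S}) G H :
  (forall g, G g -> idl H (phi g)) -> forall f, idl G f -> idl H (phi f).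
Proof.
move=> GH f; elim=> [|c g f' /GH Hg _ IH]; first by rewrite rmorph0; apply: idl0.
by rewrite rmorphD rmorphM; apply: ideal_add (idl_ideal _) _ IH; apply: ideal_mull (idl_ideal _) _.
Qed.

Definition gP (x : S) : S -> Prop := fun g => g = x.

Lemma idl_gP x f : idl (gP x) f -> exists c, f = c * x.
Proof.
elim=> [|c g f' -> _ [c' ->]]; first by exists 0; rewrite mul0r.
by exists (c + c'); rewrite mulrDl.
Qed.

Lemma idl_gPU x G f : idl (gU (gP x) G) f -> exists c g, idl G g /\ f = c * x + g.
Proof. by move=> /idl_gU[a [b [/idl_gP[c ->] Gb ->]]]; exists c, b. Qed.

Lemma idl_gPM x c : idl (gP x) (c * x).
Proof. by apply: ideal_mull (idl_ideal _) _; apply: idl_gen. Qed.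

Lemma idl_family (T : finType) (P : pred T) (F : T -> S) f :
  idl (fun g => exists2 t, P t & g = F t) f -> exists c : T -> S, f = \sum_(t | P t) c t * F t.
Proof.
elim=> [|c g f' [t Pt ->] _ [c' ->]].
  by exists (fun=> 0); rewrite big1 // => t _; rewrite mul0r.
exists (fun t' => (if t' == t then c else 0) + c' t').
under [RHS]eq_bigr do rewrite mulrDl.
rewrite big_split /=; congr (_ + _); rewrite (bigD1 t) //= eqxx big1 ?addr0 // => t' /andP[_ /negbTE ->].
by rewrite mul0r.
Qed.

Lemma mpoly_ring_ind (P : S -> Prop) :
  (forall c : k, P c%:MP) -> (forall i, P 'X_i) ->
  (forall f g, P f -> P g -> P (f + g)) -> (forall f g, P f -> P g -> P (f * g)) ->
  forall f, P f.
Proof.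
move=> PC PX PD PM f; rewrite (mpolyE f).
elim/big_rec: _ => [|m g _ Pg]; first by rewrite -(mpolyC0 N); apply: PC.
apply: PD => //; rewrite -mul_mpolyC; apply: (PM) => //.
rewrite mpolyXE_id; elim/big_rec: _ => [|i h _ Ph]; first by rewrite -(mpolyC1 N); apply: PC.
apply: (PM) => //; elim: (m i) => [|n IH]; first by rewrite expr0 -(mpolyC1 N); apply: PC.
by rewrite exprS; apply: PM.
Qed.

(** The retraction of [S] onto the polynomial subring in the variables outside [U]; it transports
    ideal membership into that subring. *)
Definition kill U : S -> S := comp_mpoly [tuple (if i \in U then 0 else 'X_i) | i < N].
HB.instance Definition _ U := GRing.RMorphism.on (kill U).

Lemma killX U i : kill U 'X_i = if i \in U then 0 else 'X_i.
Proof. by rewrite /kill comp_mpolyXU -tnth_nth tnth_mktuple. Qed.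

Lemma killC U c : kill U c%:MP = c%:MP.
Proof. exact: comp_mpolyC. Qed.

Lemma kill_kill U V f : kill U (kill V f) = kill (U :|: V) f.
Proof.
elim/mpoly_ring_ind: f => [c|i|f g Hf Hg|f g Hf Hg].
- by rewrite !killC.
- rewrite !killX inE; case: (i \in V); first by rewrite rmorph0 orbT.
  by rewrite killX orbF.
- by rewrite !rmorphD /= Hf Hg.
- by rewrite !rmorphM /= Hf Hg.
Qed.

Definition gX U : S -> Prop := fun g => exists2 i, i \in U & g = 'X_i.

Lemma sub_kill U f : idl (gX U) (f - kill U f).
Proof.
have idU := idl_ideal (gX U).
elim/mpoly_ring_ind: f => [c|i|f g Hf Hg|f g Hf Hg].
- by rewrite killC subrr; apply: idl0.
- rewrite killX; case: ifP => [iU|_]; last by rewrite subrr; apply: idl0.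
  by rewrite subr0; apply: idl_gen; exists i.
- by rewrite rmorphD opprD addrACA; apply: ideal_add.
- rewrite rmorphM (_ : _ - _ = f * (g - kill U g) + (f - kill U f) * kill U g); last by ring.
  by apply: ideal_add => //; [apply: ideal_mull|apply: ideal_mulr].
Qed.

(** Being fixed by the retraction means not involving the variables of [U]; in this form [kill U]
    visibly preserves the ideal. *)
Definition gfree U G := forall g, G g -> kill U g = g.

Lemma gfree_sub U V G : U \subset V -> gfree V G -> gfree U G.
Proof.
by move=> sUV fG g Gg; rewrite -{1}(fG g Gg) kill_kill (setUidPr sUV) fG.
Qed.

Lemma gfree_U U G H : gfree U G -> gfree U H -> gfree U (gU G H).
Proof. by move=> fG fH g []; [apply: fG|apply: fH]. Qed.

Lemma idl_kill U G f : gfree U G -> idl G f -> idl G (kill U f).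
Proof. by move=> fG; apply: idl_rmorph => g Gg; rewrite /= (fG _ Gg); apply: idl_gen. Qed.

Lemma gX1 i : forall f, idl (gX [set i]) f -> exists c, f = 'X_i * c.
Proof.
move=> f; elim=> [|c g f' [j /set1P -> ->] _ [c' ->]]; first by exists 0; rewrite mulr0.
by exists (c + c'); rewrite mulrDr [c * _]mulrC.
Qed.

Lemma mpolyX_neq0 (i : 'I_N) : ('X_i : S) != 0.
Proof. by apply/eqP => /(congr1 (mcoeff U_(i)%MM)) /eqP; rewrite mcoeffX eqxx mcoeff0 oner_eq0. Qed.

Definition nzd (x : S) I := forall f, I (x * f) -> I f.

(* Killing [x_i] in [x_i f = \sum_g c_g g] gives [\sum_g kill(c_g) g = 0], so
   every [c_g] may be replaced by [c_g - kill(c_g)], which [x_i] divides. *)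
Lemma nzd_gfree i G : gfree [set i] G -> nzd 'X_i (idl G).
Proof.
move=> fG f If.
have decomp h : idl G h -> exists2 q, idl G q & h = kill [set i] h + 'X_i * q.
  elim=> [|c g f' Gg _ [q Gq Eq]].
    by exists 0; [apply: idl0|rewrite rmorph0 mulr0 addr0].
  have [c' Ec] := gX1 (sub_kill [set i] c).
  exists (c' * g + q); first exact: idl_cons.
  have Ek : kill [set i] (c * g + f') = kill [set i] c * g + kill [set i] f'.
    by rewrite rmorphD rmorphM /= (fG _ Gg).
  rewrite Ek -[X in X * g + _](subrK (kill [set i] c)) Ec [X in _ + X]Eq; ring.
have [q Gq] := decomp _ If.
rewrite rmorphM /= killX inE eqxx mul0r add0r => /(mulfI (mpolyX_neq0 i)) ->; exact: Gq.
Qed.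

Lemma idl_divX i G h : gfree [set i] G -> idl G h ->
  exists2 q, idl G q & h = kill [set i] h + 'X_i * q.
Proof.
move=> fG Gh; have [q Eq] := gX1 (sub_kill [set i] h).
exists q; last by rewrite -Eq addrC subrK.
apply: (nzd_gfree fG); rewrite -Eq; exact: ideal_sub (idl_ideal G) Gh (idl_kill fG Gh).
Qed.

End Ideals.

(** * The Koszul complex *)

Section Koszul.

Variable R : comNzRingType.

(** The rank [2^t] of the exterior algebra, written as a sum of two halves so that block matrices
    typecheck by conversion. *)
Fixpoint kdim (t : nat) : nat := if t is t'.+1 then (kdim t' + kdim t')%N else 1%N.

(* The index of the basis vector [1] of exterior degree 0. *)
Fixpoint kone (t : nat) : 'I_(kdim t) :=
  match t return 'I_(kdim t) with
  | 0 => ord0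
  | t'.+1 => lshift (kdim t') (kone t')
  end.

(* The differential of all exterior degrees at once, acting on column vectors;
   [K(x :: s)] is the cone of [x] on [K(s)]. *)
Fixpoint kosz (s : seq R) : 'M[R]_(kdim (size s)) :=
  match s return 'M[R]_(kdim (size s)) with
  | [::] => 0
  | x :: s' => block_mx (kosz s') x%:M 0 (- kosz s')
  end.

Lemma kosz_sq s : kosz s *m kosz s = 0.
Proof.
elim: s => [|x s IH] /=; first by rewrite mulmx0.
rewrite mulmx_block !(mulmx0, mul0mx, mulmxN, mulNmx, IH, oppr0, addr0, add0r).
by rewrite mul_scalar_mx mul_mx_scalar subrr block_mx0.
Qed.

Lemma kosz_kone s i : kosz s i (kone (size s)) = 0.
Proof.
elim: s i => [|x s IH] i /=; first by rewrite mxE.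
case: (split_ordP i) => j ->; first by rewrite block_mxEul.
by rewrite block_mxEdl mxE.
Qed.

Lemma kosz_entry s i j :
  kosz s i j = 0 \/ exists2 x, x \in s & kosz s i j = x \/ kosz s i j = - x.
Proof.
elim: s i j => [|x s IH] i j /=; first by rewrite mxE; left.
case: (split_ordP i) => i' ->; case: (split_ordP j) => j' ->.
- rewrite block_mxEul; case: (IH i' j') => [->|[y ys Ey]]; first by left.
  by right; exists y => //; rewrite inE ys orbT.
- rewrite block_mxEur mxE; case: eqP => _; last by left.
  by right; exists x; [rewrite mem_head|left].
- by rewrite block_mxEdl mxE; left.
- rewrite block_mxEdr mxE; case: (IH i' j') => [->|[y ys Ey]]; first by left; rewrite oppr0.
  right; exists y; first by rewrite inE ys orbT.
  by case: Ey => ->; [right|left; rewrite opprK].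
Qed.

(** [E] is exterior multiplication by the basis vector belonging to [x]. Its entries are recorded
    because they make it homogeneous of degree 0. *)
Lemma kosz_homotopy s x : x \in s -> exists E : 'M[R]_(kdim (size s)),
  kosz s *m E + E *m kosz s = x%:M /\ forall i j, E i j \in [:: 0; 1; -1].
Proof.
elim: s => [|y s IH] //=; rewrite inE => /orP[/eqP ->|xs].
  exists (block_mx 0 0 1%:M 0); split.
    rewrite !mulmx_block !(mulmx0, mul0mx, mulmx1, mul1mx, addr0, add0r).
    by rewrite add_block_mx !(addr0, add0r) addNr -scalar_mx_block.
  move=> i j; case: (split_ordP i) => i' ->; case: (split_ordP j) => j' ->.
  - by rewrite block_mxEul mxE inE eqxx.
  - by rewrite block_mxEur mxE inE eqxx.
  - by rewrite block_mxEdl mxE; case: eqP => _ /=; rewrite !inE eqxx ?orbT.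
  - by rewrite block_mxEdr mxE inE eqxx.
have [E [EE Ee]] := IH xs; exists (block_mx E 0 0 (- E)); split.
  rewrite !mulmx_block !(mulmx0, mul0mx, mulmxN, mulNmx, addr0, add0r, opprK).
  rewrite add_block_mx !(addr0, add0r) EE mul_scalar_mx mul_mx_scalar addNr.
  by rewrite -scalar_mx_block.
move=> i j; case: (split_ordP i) => i' ->; case: (split_ordP j) => j' ->.
- by rewrite block_mxEul.
- by rewrite block_mxEur mxE inE eqxx.
- by rewrite block_mxEdl mxE inE eqxx.
- rewrite block_mxEdr mxE; move: (Ee i' j'); rewrite !inE => /or3P[]/eqP->;
    by rewrite ?oppr0 ?opprK eqxx ?orbT.
Qed.

Fixpoint seqid (s : seq R) (f : R) : Prop :=
  if s is x :: s' then exists a, seqid s' (f - a * x) else f = 0.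

(** The head is a nonzerodivisor modulo the tail, so the sequence is weakly regular when read from
    its last element; this matches the recursion of [kosz]. *)
Fixpoint regseq (s : seq R) : Prop :=
  if s is x :: s' then regseq s' /\ forall f, seqid s' (x * f) -> seqid s' f else True.

Lemma seqidN s f : seqid s f -> seqid s (- f).
Proof.
elim: s f => [|x s IH] f /=; first by move=> ->; rewrite oppr0.
by move=> [a /IH ha]; exists (- a); rewrite mulNr -opprD.
Qed.

Lemma seqid_kosz s p (z : 'M[R]_(kdim (size s), p)) l : seqid s ((kosz s *m z) (kone _) l).
Proof.
elim: s z => [|x s IH] z /=; first by rewrite mul0mx mxE.
exists (dsubmx z (kone _) l).
rewrite -{1}[z]vsubmxK mul_block_col col_mxEu mxE mul_scalar_mx.
by rewrite [X in _ + X - _]mxE mulrC addrK.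
Qed.

(** Write [z] as [(z1, z2)]: then [z2] is a cycle for the tail and [K z1 = - x z2]. In the
    coordinate [kone] this puts [x z2], hence [z2], in the tail ideal, so [z2 = K w2] by induction
    and [z1 + x w2] is a cycle. The condition on [kone] rules out the homology in exterior degree
    0. *)
Lemma kosz_acyclic s p (z : 'M[R]_(kdim (size s), p)) : regseq s ->
  kosz s *m z = 0 -> (forall l, seqid s (z (kone _) l)) -> exists w, z = kosz s *m w.
Proof.
elim: s z => [|x s IH] z /=.
  move=> _ _ z0; exists 0; rewrite mulmx0; apply/matrixP => i l.
  by rewrite [i]ord1 z0 mxE.
move=> [regs nzdx]; rewrite -[z]vsubmxK; move: (usubmx z) (dsubmx z) => z1 z2.
rewrite mul_block_col mul_scalar_mx mul0mx add0r mulNmx.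
move=> /(congr1 (fun M => (usubmx M, dsubmx M))); rewrite col_mxKu col_mxKd.
have -> : usubmx (0 : 'M[R]_(kdim (size s) + kdim (size s), p)) = 0 by apply/matrixP => i j; rewrite !mxE.
have -> : dsubmx (0 : 'M[R]_(kdim (size s) + kdim (size s), p)) = 0 by apply/matrixP => i j; rewrite !mxE.
move=> -[E1 /eqP]; rewrite oppr_eq0 => /eqP E2 hz.
have [w2 Ew2] : exists w, z2 = kosz s *m w.
  apply: (IH) => // l; apply: nzdx.
  move/matrixP/(_ (kone _) l): E1; rewrite mxE [X in _ + X]mxE [RHS]mxE => /eqP.
  rewrite addr_eq0 => /eqP/(congr1 -%R); rewrite opprK => <-.
  by apply: seqidN; apply: seqid_kosz.
(* The [kone] coordinate of [z1 + x w2] lies in the tail ideal only up to a multiple [x b]. The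
   vector [B] carrying [b] in that coordinate is a cycle, so [x B] can be subtracted here and
   absorbed in the second component of the preimage. *)
have [b hb] : exists b : 'rV[R]_p, forall l, seqid s ((z1 + x *: w2) (kone _) l - x * b 0 l).
  have /fin_all_exists[a ha] : forall l, exists a, seqid s (z1 (kone _) l - a * x).
    by move=> l; have := hz l; rewrite col_mxEu.
  exists (\row_l (a l + w2 (kone _) l)) => l; rewrite !mxE.
  by rewrite (_ : _ - _ = z1 (kone (size s)) l - a l * x) //; ring.
pose B : 'M[R]_(kdim (size s), p) := \matrix_(i, l) (if i == kone (size s) then b 0 l else 0).
have KB : kosz s *m B = 0.
  apply/matrixP => i l; rewrite !mxE big1 // => j _; rewrite mxE.
  by case: eqP => [->|_]; rewrite ?kosz_kone ?mul0r ?mulr0.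
have [w1 Ew1] : exists w, z1 + x *: w2 - x *: B = kosz s *m w.
  apply: (IH) => // [|l].
    rewrite mulmxBr mulmxDr -!scalemxAr KB scaler0 subr0 -Ew2 //.
  have := hb l; rewrite !mxE eqxx; exact.
exists (col_mx w1 (B - w2)); rewrite mul_block_col mul_scalar_mx mul0mx add0r.
congr col_mx; first by rewrite -Ew1 scalerBr addrA subrK addrK.
by rewrite mulNmx mulmxBr KB sub0r opprK.
Qed.

End Koszul.

(** * Regularity through Koszul homology *)

Section GradedMatrices.

Variables (k : fieldType) (N : nat).
Local Notation S := {mpoly k[N]}.

(** Such a matrix is an element of the tensor product of the Koszul complex (rows) with a graded
    free module having basis degrees [sh] (columns). Left multiplication by the Koszul matrix raises
    [e] by 1; right multiplication by a degree-preserving map keeps it. *)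
Definition hmat m p (sh : 'I_p -> int) (e : int) (y : 'M[S]_(m, p)) :=
  forall i l, homogeneous (e - sh l) (y i l).

Definition hproj m p (sh : 'I_p -> int) (e : int) (y : 'M[S]_(m, p)) : 'M[S]_(m, p) :=
  \matrix_(i, l) hcomp (e - sh l) (y i l).

Lemma hmat_hproj m p (sh : 'I_p -> int) e (y : 'M[S]_(m, p)) : hmat sh e (hproj sh e y).
Proof. by move=> i l; rewrite mxE; apply: homog_hcomp. Qed.

Lemma hproj_id m p (sh : 'I_p -> int) e (y : 'M[S]_(m, p)) : hmat sh e y -> hproj sh e y = y.
Proof. by move=> hy; apply/matrixP => i l; rewrite mxE hcomp_id. Qed.

Lemma hprojD m p (sh : 'I_p -> int) e (y z : 'M[S]_(m, p)) :
  hproj sh e (y + z) = hproj sh e y + hproj sh e z.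
Proof. by apply/matrixP => i l; rewrite !mxE hcompD. Qed.

Lemma hprojN m p (sh : 'I_p -> int) e (y : 'M[S]_(m, p)) : hproj sh e (- y) = - hproj sh e y.
Proof. by apply/matrixP => i l; rewrite !mxE hcompN. Qed.

Lemma hprojB m p (sh : 'I_p -> int) e (y z : 'M[S]_(m, p)) :
  hproj sh e (y - z) = hproj sh e y - hproj sh e z.
Proof. by rewrite hprojD hprojN. Qed.

Lemma hmatD m p (sh : 'I_p -> int) e (y z : 'M[S]_(m, p)) :
  hmat sh e y -> hmat sh e z -> hmat sh e (y + z).
Proof. by move=> hy hz i l; rewrite mxE; apply: homogD. Qed.

Lemma hmatN m p (sh : 'I_p -> int) e (y : 'M[S]_(m, p)) : hmat sh e y -> hmat sh e (- y).
Proof. by move=> hy i l; rewrite mxE; apply: homogN. Qed.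

Lemma hmatB m p (sh : 'I_p -> int) e (y z : 'M[S]_(m, p)) :
  hmat sh e y -> hmat sh e z -> hmat sh e (y - z).
Proof. by move=> hy hz; apply: hmatD => //; apply: hmatN. Qed.

Lemma hproj_mull q m p (sh : 'I_p -> int) c e (C : 'M[S]_(q, m)) (y : 'M[S]_(m, p)) :
  (forall i j, homogeneous c (C i j)) -> hproj sh (e + c) (C *m y) = C *m hproj sh e y.
Proof.
move=> hC; apply/matrixP => i l; rewrite !mxE hcomp_sum; apply: eq_bigr => j _.
by rewrite mxE addrAC hcompMl.
Qed.

Lemma hmat_mull q m p (sh : 'I_p -> int) c e (C : 'M[S]_(q, m)) (y : 'M[S]_(m, p)) :
  (forall i j, homogeneous c (C i j)) -> hmat sh e y -> hmat sh (e + c) (C *m y).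
Proof. by move=> hC hy; rewrite -(hproj_id hy) -(@hproj_mull _ _ _ _ c) //; apply: hmat_hproj. Qed.

Definition hmap p q (sp : 'I_p -> int) (sq : 'I_q -> int) (A : 'M[S]_(p, q)) :=
  forall a b, homogeneous (sp a - sq b) (A a b).

Lemma hproj_mulr m p q (sp : 'I_p -> int) (sq : 'I_q -> int) e
    (y : 'M[S]_(m, p)) (A : 'M[S]_(p, q)) :
  hmap sp sq A -> hproj sq e (y *m A) = hproj sp e y *m A.
Proof.
move=> hA; apply/matrixP => i l; rewrite !mxE hcomp_sum; apply: eq_bigr => j _.
rewrite mxE mulrC (_ : e - sq l = (e - sp j) + (sp j - sq l)); last by ring.
by rewrite hcompMl // mulrC.
Qed.

Lemma hmat_mulr m p q (sp : 'I_p -> int) (sq : 'I_q -> int) e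
    (y : 'M[S]_(m, p)) (A : 'M[S]_(p, q)) :
  hmap sp sq A -> hmat sp e y -> hmat sq e (y *m A).
Proof. by move=> hA hy; rewrite -(hproj_id hy) -(hproj_mulr _ _ hA); apply: hmat_hproj. Qed.

Definition inmx (I : S -> Prop) m p (z : 'M[S]_(m, p)) := forall i l, I (z i l).

Lemma inmxD I m p (y z : 'M[S]_(m, p)) : ideal I -> inmx I y -> inmx I z -> inmx I (y + z).
Proof. by move=> idI hy hz i l; rewrite mxE; apply: ideal_add. Qed.

Lemma inmxN I m p (y : 'M[S]_(m, p)) : ideal I -> inmx I y -> inmx I (- y).
Proof. by move=> idI hy i l; rewrite mxE; apply: ideal_opp. Qed.

Lemma inmxB I m p (y z : 'M[S]_(m, p)) : ideal I -> inmx I y -> inmx I z -> inmx I (y - z).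
Proof. by move=> idI hy hz; apply: inmxD => //; apply: inmxN. Qed.

Lemma inmx_mull I q m p (C : 'M[S]_(q, m)) (y : 'M[S]_(m, p)) :
  ideal I -> inmx I y -> inmx I (C *m y).
Proof. by move=> idI hy i l; rewrite mxE; apply: ideal_sum => // j _; apply: ideal_mull. Qed.

Lemma inmx_hproj I m p (sh : 'I_p -> int) e (y : 'M[S]_(m, p)) :
  hideal I -> inmx I y -> inmx I (hproj sh e y).
Proof. by move=> [_ hI] hy i l; rewrite mxE; apply: hI. Qed.

End GradedMatrices.

(** * Koszul vanishing under intersections and under adding a variable *)

Section Regularity.

Variables (k : fieldType) (N : nat).
Local Notation S := {mpoly k[N]}.
Implicit Types (I J : S -> Prop).

Definition pvars : seq S := [seq 'X_i | i <- enum 'I_N].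
Definition KD := kosz pvars.
Definition K0 : 'I_(kdim (size pvars)) := kone _.

Lemma seqidX (s : seq 'I_N) (f : S) :
  seqid [seq 'X_i | i <- s] f <-> idl (gX [set i in s]) f.
Proof.
elim: s f => [|i s IH] f /=; split.
- by move=> ->; apply: idl0.
- by elim=> // c g f' [j]; rewrite inE.
- move=> [a /IH ha]; rewrite -(subrK (a * 'X_i) f); apply: ideal_add (idl_ideal _) _ _.
    apply: idl_sub ha => g [j]; rewrite inE => js ->; apply: idl_gen; exists j => //.
    by rewrite inE inE js orbT.
  apply: ideal_mull (idl_ideal _) _; apply: idl_gen; exists i => //.
  by rewrite inE mem_head.
- elim=> [|c g f' [j]]; first by exists 0; apply/IH; rewrite mul0r subr0; apply: idl0.
  rewrite inE inE => /orP[/eqP ->|js] -> _ [a /IH ha].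
    by exists (a + c); apply/IH; rewrite (_ : _ - _ = f' - a * 'X_i) //; ring.
  exists a; apply/IH; rewrite -addrA; apply: idl_cons => //.
  by exists j; rewrite ?inE.
Qed.

Lemma regseqX (s : seq 'I_N) : uniq s -> regseq [seq 'X_i : S | i <- s].
Proof.
elim: s => //= i s IH /andP[nis us]; split; first exact: IH.
move=> f /seqidX h; apply/seqidX; move: h; apply: nzd_gfree => g [j].
rewrite inE => js ->; rewrite killX inE; case: eqP => // eqji.
by rewrite -eqji js in nis.
Qed.

Lemma kill_setT (f : S) : kill setT f = (f@_0%MM)%:MP.
Proof.
elim/mpoly_ring_ind: f => [c|i|f g Hf Hg|f g Hf Hg].
- by rewrite killC mcoeffC eqxx mulr1.
- by rewrite killX inE mcoeffX mnm1_eq0 mpolyC0.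
- by rewrite rmorphD /= Hf Hg mcoeffD mpolyCD.
- by rewrite rmorphM /= Hf Hg rmorphM mpolyCM.
Qed.

Lemma pvars_mcoeff0 (f : S) : f@_0%MM = 0 -> seqid pvars f.
Proof.
move=> f0; apply/seqidX; have := sub_kill setT f.
rewrite kill_setT f0 mpolyC0 subr0; apply: idl_sub => g [i _ ->].
by apply: idl_gen; exists i; rewrite // inE mem_enum.
Qed.

Lemma KD_homog i j : homogeneous 1 (KD i j).
Proof.
rewrite /KD; case: (kosz_entry i j) => [->|[x /mapP[l _ ->] []->]]; first exact: homog0.
  exact: homogX.
by apply: homogN; apply: homogX.
Qed.

Lemma KD_sq : KD *m KD = 0. Proof. exact: kosz_sq. Qed.

(** The variables form a regular sequence with quotient [k], so a constant term in the row [K0] is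
    the only obstruction. *)
Lemma KD_acyclic p (sh : 'I_p -> int) e (y : 'M[S]_(_, p)) :
  hmat sh e y -> KD *m y = 0 -> (forall l, (y K0 l)@_0%MM = 0) ->
  exists w, hmat sh (e - 1) w /\ y = KD *m w.
Proof.
move=> hy Dy y0.
have [||w Ew] := @kosz_acyclic _ pvars _ y _ Dy.
- by apply: regseqX; apply: enum_uniq.
- by move=> l; apply: pvars_mcoeff0.
exists (hproj sh (e - 1) w); split; first exact: hmat_hproj.
by rewrite -(hproj_mull _ _ _ KD_homog) subrK -/KD -Ew hproj_id.
Qed.

Definition sh0 : 'I_1 -> int := fun=> 0.

(* Entries of [z] of polynomial degree [e] sitting in homological degree [i]
   have internal degree [e + i], so this says [Tor_i(S/I, k)_j = 0] for [j - i > r]. *)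
Definition regle I (r : nat) := forall (e : int) (z : 'M[S]_(_, 1)),
  r%:Z < e -> hmat sh0 e z -> inmx I (KD *m z) ->
  exists w, hmat sh0 (e - 1) w /\ inmx I (z - KD *m w).

Lemma regle_mono I r r' : (r <= r')%N -> regle I r -> regle I r'.
Proof. by move=> le h e z re; apply: h; apply: le_lt_trans re; rewrite lez_nat. Qed.

Lemma regle_ext I J r : (forall f, I f <-> J f) -> regle I r -> regle J r.
Proof.
move=> IJ h e z re hz Dz; have [|w [hw zw]] := h e z re hz.
  by move=> i l; apply/IJ.
by exists w; split=> // i l; apply/IJ.
Qed.

Lemma regle0 : regle (idl (fun _ : S => False)) 0.
Proof.
have z0 f : idl (fun _ : S => False) f -> f = 0 by elim.
move=> e z e0 hz Dz; have [|l|w [hw zw]] := KD_acyclic hz.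
- by apply/matrixP => i l; rewrite (z0 _ (Dz i l)) mxE.
- by apply: (homog_mcoeff0 (hz K0 l)); rewrite subr0 gt_eqF.
by exists w; split=> //; rewrite -zw subrr => i l; rewrite mxE; apply: idl0.
Qed.

Lemma inmx_isum I J m p (sh : 'I_p -> int) e (z : 'M[S]_(m, p)) : hideal I -> hideal J ->
  hmat sh e z -> inmx (isum I J) z ->
  exists a b, [/\ inmx I a, inmx J b, z = a + b, hmat sh e a & hmat sh e b].
Proof.
move=> hI hJ hz Iz.
have /fin_all_exists[a /= ha] : forall i, exists a : 'I_p -> S, forall l, I (a l) /\ J (z i l - a l).
  move=> i; have /fin_all_exists[a ha] : forall l, exists a, I a /\ J (z i l - a).
    by move=> l; have [a [b [Ia Jb ->]]] := Iz i l; exists a; rewrite addrC addKr.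
  by exists a.
pose A := hproj sh e (\matrix_(i, l) a i l).
have hA : hmat sh e A by apply: hmat_hproj.
exists A, (z - A); split=> //; last exact: hmatB.
- by apply: inmx_hproj => // i l; rewrite mxE; case: (ha i l).
- rewrite /A -{1}(hproj_id hz) -hprojB; apply: inmx_hproj => // i l.
  by rewrite !mxE; case: (ha i l).
- by rewrite addrC subrK.
Qed.

(** Mayer-Vietoris by hand. If [z] is [K wI] modulo [I] and [K wJ] modulo [J], then [wI - wJ] is a
    cycle modulo [I + J] of degree [e - 1], hence equals [K u + a + b] with [a] in [I] and [b] in
    [J]. Then [wI - a = wJ + b + K u] is a preimage for both ideals. The drop from [e] to [e - 1]
    explains the successor. *)
Lemma regle_int I J r : hideal I -> hideal J -> regle I r.+1 -> regle J r.+1 ->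
  regle (isum I J) r -> regle (iint I J) r.+1.
Proof.
move=> hI hJ rI rJ rIJ e z re hz Dz.
have [idI idJ] : ideal I /\ ideal J by split; [case: hI|case: hJ].
have [wI [hwI zI]] := rI e z re hz (fun i l => proj1 (Dz i l)).
have [wJ [hwJ zJ]] := rJ e z re hz (fun i l => proj2 (Dz i l)).
have [|||u [hu wu]] := rIJ (e - 1) (wI - wJ).
- by lia.
- exact: hmatB.
- move=> i l; exists (- (z - KD *m wI) i l), ((z - KD *m wJ) i l).
  split=> //; first exact: ideal_opp.
  by rewrite mulmxBr !mxE; ring.
have hd : hmat sh0 (e - 1) (wI - wJ - KD *m u).
  apply: hmatB; first exact: hmatB.
  by rewrite -(subrK 1 (e - 1)); apply: hmat_mull => //; apply: KD_homog.
have [a [b [Ia Jb Eab ha hb]]] := inmx_isum hI hJ hd wu.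
exists (wI - a); split; first exact: hmatB.
move=> i l; split.
  rewrite mulmxBr opprB addrA addrAC; apply: inmxD => //; exact: inmx_mull.
rewrite (_ : wI - a = wJ + b + KD *m u).
  rewrite !mulmxDr mulmxA KD_sq mul0mx addr0 opprD addrA; apply: inmxB => //; exact: inmx_mull.
by move/eqP: Eab; rewrite subr_eq => /eqP/(congr1 (fun x => x + wJ - a)); rewrite subrK => ->;
   apply/matrixP => x y; rewrite !mxE; ring.
Qed.

Definition addX x I f := exists c b : S, I b /\ f = x * c + b.

Lemma inmx_addX x I m (z : 'M[S]_(m, 1)) e : homogeneous 1 x -> hideal I ->
  hmat sh0 e z -> inmx (addX x I) z ->
  exists c, hmat sh0 (e - 1) c /\ inmx I (z - x *: c).
Proof.
move=> hx hI hz Iz.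
have /fin_all_exists[c hc] : forall i, exists c, I (z i 0 - x * c).
  by move=> i; have [c [b [Ib ->]]] := Iz i 0; exists c; rewrite addrC addKr.
pose C := hproj sh0 (e - 1) (\matrix_(i, l) c i); exists C.
split; first exact: hmat_hproj.
have -> : x *: C = hproj sh0 e (x *: \matrix_(i, l) c i).
  apply/matrixP => i l; rewrite !mxE.
  by rewrite [e - sh0 l in RHS](_ : _ = e - 1 - sh0 l + 1) ?hcompMl //; ring.
rewrite -{1}(hproj_id hz) -hprojB; apply: inmx_hproj => // i l.
by rewrite !mxE [l]ord1.
Qed.

(** If [K z = x c] modulo [I], then [c] is a cycle modulo [I] because [x] is a nonzerodivisor. It
    has the same degree as [z], so [c = K w] modulo [I], and [z - x w] is a cycle modulo [I]
    congruent to [z] modulo [x]. *)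
Lemma regle_addX i I r : hideal I -> nzd 'X_i I -> regle I r -> regle (addX 'X_i I) r.
Proof.
move=> hI nz rI e z re hz Dz; have [idI _] := hI.
have hDz : hmat sh0 (e + 1) (KD *m z) by apply: hmat_mull => //; apply: KD_homog.
have [c [hc Ic]] := inmx_addX (@homogX _ _ _) hI hDz Dz.
rewrite addrK in hc.
have [|w [hw cw]] := rI e c re hc.
  move=> a l; apply: nz.
  suff -> : 'X_i * (KD *m c) a l = - (KD *m (KD *m z - 'X_i *: c)) a l.
    by apply: ideal_opp => //; apply: inmx_mull.
  by rewrite mulmxBr mulmxA KD_sq mul0mx sub0r -scalemxAr [in RHS]mxE opprK [in RHS]mxE.
have hxw : hmat sh0 e ('X_i *: w).
  move=> a l; rewrite mxE (_ : e - sh0 l = 1 + (e - 1 - sh0 l)); last by ring.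
  by apply: homogM; [exact: homogX|exact: hw].
have [|u [hu zu]] := rI e (z - 'X_i *: w) re (hmatB hz hxw).
  rewrite mulmxBr -scalemxAr -[KD *m z](subrK ('X_i *: c)) -addrA -scalerBr.
  apply: inmxD => // a l; rewrite mxE; apply: ideal_mull => //; exact: cw.
exists u; split=> // a l; exists (w a l), ((z - 'X_i *: w - KD *m u) a l).
by split=> //; rewrite !mxE; ring.
Qed.

(* Multiplication by [X_i] is null-homotopic on the Koszul complex. *)
Lemma regle_subX i I r : hideal I -> nzd 'X_i I -> regle (addX 'X_i I) r -> regle I r.
Proof.
move=> hI nz rI e z re hz Dz; have [idI _] := hI.
have [|w [hw zw]] := rI e z re hz.
  by move=> a l; exists 0, ((KD *m z) a l); rewrite mulr0 add0r.
have hDw : hmat sh0 e (KD *m w).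
  by rewrite -(subrK 1 e); apply: hmat_mull => //; apply: KD_homog.
have [c [hc Ic]] := inmx_addX (@homogX _ _ _) hI (hmatB hz hDw) zw.
have Dc : inmx I (KD *m c).
  move=> a l; apply: nz.
  suff -> : 'X_i * (KD *m c) a l = (KD *m z - KD *m (z - KD *m w - 'X_i *: c)) a l.
    by apply: inmxB => //; apply: inmx_mull.
  by rewrite !mulmxBr mulmxA KD_sq mul0mx subr0 opprB addrCA subrr addr0 -scalemxAr [in RHS]mxE.
have [|E [EE Ee]] := @kosz_homotopy _ pvars 'X_i; first by apply: map_f; rewrite mem_enum.
exists (w + E *m c); split.
  apply: hmatD => //; rewrite -[e - 1]addr0; apply: hmat_mull => // a b.
  have := Ee a b; rewrite !inE => /or3P[]/eqP->; first exact: homog0.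
    by rewrite -mpolyC1; apply: homogC.
  by apply: homogN; rewrite -mpolyC1; apply: homogC.
suff -> : z - KD *m (w + E *m c) = (z - KD *m w - 'X_i *: c) + E *m (KD *m c).
  by apply: inmxD => //; apply: inmx_mull.
rewrite mulmxDr opprD addrA -[RHS]addrA; congr (_ + _).
by rewrite -mul_scalar_mx -EE mulmxDl opprD !mulmxA -addrA addNr addr0.
Qed.

End Regularity.

(** * Syzygies and their generators *)

Section Submodules.

Variables (k : fieldType) (N : nat).
Local Notation S := {mpoly k[N]}.
Local Notation KD := (@KD k N).
Local Notation K0 := (@K0 k N).
Implicit Types (I : S -> Prop).

Definition submod p (Z : 'rV[S]_p -> Prop) :=
  [/\ Z 0, forall u v, Z u -> Z v -> Z (u + v) & forall c v, Z v -> Z (c *: v)].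

Definition gsubmod p (sh : 'I_p -> int) (Z : 'rV[S]_p -> Prop) :=
  submod Z /\ forall e v, Z v -> Z (hproj sh e v).

Definition inZ m p (Z : 'rV[S]_p -> Prop) (y : 'M[S]_(m, p)) := forall i, Z (row i y).

Lemma submod_sum p (Z : 'rV[S]_p -> Prop) (T : Type) (s : seq T) (P : pred T) F :
  submod Z -> (forall t, P t -> Z (F t)) -> Z (\sum_(t <- s | P t) F t).
Proof. by case=> Z0 ZD ZM hF; elim/big_rec: _ => // t v Pt; apply: ZD; apply: hF. Qed.

(* For [Z] the [i]-th syzygies inside [F_i] and [b = r + i], this expresses the
   Koszul vanishing for [S/I] carried [i] steps along the double complex; [e] is
   the internal degree minus the exterior degree. *)
Definition star p (sh : 'I_p -> int) (Z : 'rV[S]_p -> Prop) (b : int) :=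
  forall e (y : 'M[S]_(_, p)), b < e -> hmat sh e y -> (forall l, y K0 l = 0) ->
  inZ Z (KD *m y) -> exists y', hmat sh (e - 1) y' /\ inZ Z (y - KD *m y').

Lemma lift_rows m p q (Z : 'rV[S]_p -> Prop) (A : 'M[S]_(q, p)) (y : 'M[S]_(m, p)) :
  (forall v, Z v -> exists w, v = w *m A) -> inZ Z y -> exists C, y = C *m A.
Proof.
move=> im hy; have /fin_all_exists[c hc] : forall i, exists c, row i y = c *m A.
  by move=> i; apply: im.
by exists (\matrix_i c i); apply/row_matrixP => i; rewrite row_mul rowK.
Qed.

(** Push [y] to [S/I] along the augmentation, use the vanishing there, and lift the preimage back
    row by row by surjectivity. *)
Lemma star_base I r p (sh : 'I_p -> int) (a : 'cV[S]_p) : hideal I -> regle I r ->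
  hmap sh (sh0) a -> (forall f, exists v : 'rV_p, I (f - (v *m a) 0 0)) ->
  forall e (y : 'M[S]_(_, p)), r%:Z < e -> hmat sh e y ->
  inZ (fun v => I ((v *m a) 0 0)) (KD *m y) ->
  exists y', hmat sh (e - 1) y' /\ inZ (fun v => I ((v *m a) 0 0)) (y - KD *m y').
Proof.
move=> hI rI ha sur e y re hy Dy; have [idI _] := hI.
have row_a m (z : 'M_(m, p)) i : (row i z *m a) 0 0 = (z *m a) i 0.
  by rewrite -row_mul mxE.
have [|w [hw yw]] := rI e (y *m a) re (hmat_mulr ha hy).
  by move=> i l; rewrite [l]ord1 mulmxA -row_a.
have /fin_all_exists[c hc] : forall i, exists c : 'rV_p, I (w i 0 - (c *m a) 0 0).
  by move=> i; apply: sur.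
pose C := hproj sh (e - 1) (\matrix_i c i).
have wC : inmx I (w - C *m a).
  rewrite -(hproj_mulr _ _ ha) -{1}(hproj_id hw) -hprojB.
  apply: inmx_hproj => // i l; rewrite [l]ord1 mxE [X in _ + X]mxE -row_a rowK.
  exact: hc.
exists C; split; first exact: hmat_hproj.
move=> i; rewrite row_a (_ : _ *m a = (y *m a - KD *m w) + KD *m (w - C *m a)).
  by rewrite mxE; apply: ideal_add => //; apply: inmx_mull.
by rewrite mulmxBl mulmxBr addrA subrK mulmxA.
Qed.

(** Clears the component of exterior degree 0, which the Koszul differential annihilates anyway;
    [star] asks for this normalisation. *)
Definition zrow m p (i0 : 'I_m) (y : 'M[S]_(m, p)) : 'M[S]_(m, p) :=
  \matrix_(i, l) if i == i0 then 0 else y i l.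

Lemma KD_zrow p (y : 'M[S]_(_, p)) : KD *m zrow K0 y = KD *m y.
Proof.
apply/matrixP => i l; rewrite !mxE; apply: eq_bigr => j _; rewrite mxE.
by case: eqP => // ->; rewrite /KD kosz_kone !mul0r.
Qed.

Lemma hmat_zrow m p (sh : 'I_p -> int) e i0 (y : 'M[S]_(m, p)) :
  hmat sh e y -> hmat sh e (zrow i0 y).
Proof. by move=> hy i l; rewrite mxE; case: ifP => _; [apply: homog0|apply: hy]. Qed.

Lemma KD_acyclic0 p (sh : 'I_p -> int) e (y : 'M[S]_(_, p)) :
  hmat sh e y -> KD *m y = 0 -> (forall l, (y K0 l)@_0%MM = 0) ->
  exists w, [/\ hmat sh (e - 1) w, forall l, w K0 l = 0 & y = KD *m w].
Proof.
move=> hy Dy y0; have [w [hw Ew]] := KD_acyclic hy Dy y0.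
exists (zrow K0 w); split; [exact: hmat_zrow| |by rewrite KD_zrow].
by move=> l; rewrite mxE eqxx.
Qed.

(** One step of the zigzag: [y A] is a Koszul cycle, so [y A = K y2]; [star] corrects [y2] to
    [y2 - K y2'] in [Z], which is [C A] for some [C]; then [(y - K C) A = 0]. Passing from [y] to
    [y2] costs one degree. The row [K0] may be nonzero as long as its image has no constant term,
    which covers lifts of cycles of the complex tensored with [k]. *)
Lemma star_step p p' (sh : 'I_p -> int) (sh' : 'I_p' -> int) Z b (A : 'M[S]_(p', p)) :
  star sh Z b -> hmap sh' sh A -> (forall v, Z v <-> exists w, v = w *m A) ->
  forall e (y : 'M[S]_(_, p')), b + 1 < e -> hmat sh' e y ->
  (forall l, ((y *m A) K0 l)@_0%MM = 0) -> KD *m y *m A = 0 ->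
  exists y', hmat sh' (e - 1) y' /\ (y - KD *m y') *m A = 0.
Proof.
move=> st hA im e y be hy y0 DyA.
have [|y2 [hy2 y20 Ey2]] := KD_acyclic0 (hmat_mulr hA hy) _ y0; first by rewrite mulmxA.
have [||y2' [hy2' Zy2]] := st (e - 1) y2 _ hy2 y20; first by lia.
  by move=> i; rewrite -Ey2 row_mul; apply/im; exists (row i y).
have [C EC] := lift_rows (fun v => (im v).1) Zy2.
exists (hproj sh' (e - 1) C); split; first exact: hmat_hproj.
rewrite mulmxBl -mulmxA -(hproj_mulr _ _ hA) -EC hproj_id; last first.
  apply: hmatB => //; rewrite -(subrK 1 (e - 1)); apply: hmat_mull => //; exact: KD_homog.
by rewrite mulmxBr mulmxA KD_sq mul0mx subr0 -Ey2 subrr.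
Qed.

Lemma star_ker p p' (sh : 'I_p -> int) (sh' : 'I_p' -> int) Z b (A : 'M[S]_(p', p)) :
  star sh Z b -> hmap sh' sh A -> (forall v, Z v <-> exists w, v = w *m A) ->
  star sh' (fun v => v *m A = 0) (b + 1).
Proof.
move=> st hA im e y be hy y0 Dy.
have [||y' [hy' Ey']] := star_step st hA im be hy.
- by move=> l; rewrite mxE big1 ?mcoeff0 // => j _; rewrite y0 mul0r.
- by apply/row_matrixP => i; rewrite row_mul Dy row0.
by exists y'; split=> // i; rewrite -row_mul Ey' row0.
Qed.

Definition erow m p (i0 : 'I_m) (v : 'rV[S]_p) : 'M[S]_(m, p) :=
  \matrix_(i, l) if i == i0 then v 0 l else 0.

Lemma row_erow m p (i0 : 'I_m) (v : 'rV[S]_p) : row i0 (erow i0 v) = v.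
Proof. by apply/rowP => l; rewrite !mxE eqxx. Qed.

Lemma hmat_erow m p (sh : 'I_p -> int) e (i0 : 'I_m) (v : 'rV[S]_p) :
  hmat sh e v -> hmat sh e (erow i0 v).
Proof. by move=> hv i l; rewrite mxE; case: ifP => _; [apply: hv|apply: homog0]. Qed.

Lemma KD_erow p (v : 'rV[S]_p) : KD *m erow K0 v = 0.
Proof.
apply/matrixP => i l; rewrite !mxE big1 // => j _; rewrite mxE.
by case: eqP => [->|_]; rewrite ?mulr0 // /KD kosz_kone mul0r.
Qed.

(** The conclusion writes [v] as a combination of variables with coefficients in [Z] of degree
    [e - 1], so [Z] has no minimal generator above degree [b + 1]. Since [sh l <= b < e], the
    element [v] placed in exterior degree 0 has no constant terms and is a Koszul boundary [K w];
    [star] moves [w] into [Z]. *)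
Lemma star_gen p (sh : 'I_p -> int) Z b : star sh Z b -> gsubmod sh Z ->
  (forall l, sh l <= b) -> forall e (v : 'rV[S]_p), b + 1 < e -> hmat sh e v -> Z v ->
  exists Y, [/\ inZ Z Y, hmat sh (e - 1) Y & v = row K0 (KD *m Y)].
Proof.
move=> st [sZ _] leb e v be hv Zv; have [Z0 _ _] := sZ.
have [l|w [hw w0 Ew]] := KD_acyclic0 (hmat_erow (i0 := K0) hv) (KD_erow v).
  rewrite mxE eqxx; apply: (homog_mcoeff0 (hv 0 l)).
  by have := leb l; lia.
have [||y' [hy' Zy']] := st (e - 1) w _ hw w0; first by lia.
  move=> i; rewrite -Ew; have [->|/negbTE neq] := eqVneq i K0; first by rewrite row_erow.
  by rewrite (_ : row i _ = 0) //; apply/rowP => l; rewrite !mxE neq.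
exists (w - KD *m y'); split=> //.
  apply: hmatB => //; rewrite -(subrK 1 (e - 1)); apply: hmat_mull => //; exact: KD_homog.
by rewrite mulmxBr mulmxA KD_sq mul0mx subr0 -Ew row_erow.
Qed.

Lemma span_deg p (sh : 'I_p -> int) e : exists q (g : 'M[S]_(q, p)),
  forall v : 'rV[S]_p, hmat sh e v -> exists c : 'rV[k]_q, v = map_mx (@mpolyC N k) c *m g.
Proof.
(* Bounded monomials form a finite type. The family may contain monomials of other degrees, since
   only spanning is asked of it. *)
pose D := (\max_(l < p) `|e - sh l|.+1)%N.
pose T : finType := ('I_p * 'X_{1..N < D})%type.
pose ev (i : 'I_#|T|) : 'I_p * 'X_{1..N < D} := enum_val i.
exists #|T|, (\matrix_(i, l) if (ev i).1 == l then 'X_[(ev i).2] else 0).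
move=> v hv; exists (\row_i mcoeff (ev i).2 (v 0 (ev i).1)).
apply/rowP => l; rewrite mxE.
have sz : (msize (v 0%R l) <= D)%N.
  apply: (@leq_trans `|e - sh l|.+1).
    by rewrite msizeE; apply/bigmax_leqP_seq => m mv _; have := hv 0 l m mv; lia.
  exact: (leq_bigmax (F := fun l => `|e - sh l|.+1)).
under [RHS]eq_bigr do rewrite !mxE.
rewrite -(big_enum_val (A := T) (fun u : 'I_p * 'X_{1..N < D} => (mcoeff u.2 (v 0 u.1))%:MP * (if u.1 == l then 'X_[u.2] else 0))) /=.
rewrite -(pair_bigA _ (fun a (m : 'X_{1..N < D}) => ((v 0 a)@_m)%:MP * (if a == l then 'X_[m] else 0))) /=.
rewrite (bigD1 l) //= [X in _ + X]big1 ?addr0 => [|a /negbTE neq].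
  rewrite eqxx {1}(mpolywE sz); apply: eq_bigr => m _; by rewrite mul_mpolyC.
by rewrite neq big1 // => m _; rewrite mulr0.
Qed.

(** The predicate is not decidable, so a vector missing from the current row space is obtained
    classically and appended; the rank grows, and it is at most [q]. *)
Lemma subspace_basis q (P : 'rV[k]_q -> Prop) :
  P 0 -> (forall u v, P u -> P v -> P (u + v)) -> (forall c v, P v -> P (c *: v)) ->
  exists r (C : 'M[k]_(r, q)), forall c, P c <-> (c <= C)%MS.
Proof.
move=> P0 PD PM.
have PC r (C : 'M[k]_(r, q)) : (forall i, P (row i C)) -> forall c, (c <= C)%MS -> P c.
  move=> hC c /submxP[D ->]; rewrite mulmx_sum_row.
  by elim/big_rec: _ => // i u _ Pu; apply: PD => //; apply: PM.
suff: forall n r (C : 'M[k]_(r, q)), (q - \rank C <= n)%N -> (forall i, P (row i C)) ->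
    exists r (C : 'M[k]_(r, q)), forall c, P c <-> (c <= C)%MS.
  by move=> /(_ q 0%N 0); apply; [rewrite leq_subr|case].
move=> n; elim: n => [|n IH] r C hr hC.
  exists r, C => c; split; last exact: PC.
  move=> _; apply: submx_full; rewrite /row_full eqn_leq rank_leq_col /=; lia.
have [full|/not_all_ex_not[c]] := classic (forall c, P c -> (c <= C)%MS).
  by exists r, C => c; split; [apply: full|apply: PC].
move=> h; have [Pc nc0] := imply_to_and _ _ h; have nc := introN idP nc0.
apply: (IH _ (col_mx C c)).
  have lt : (C < col_mx C c)%MS.
    rewrite ltmxE col_mx_sub submx_refl /= nc andbT.
    by have := submx_refl (col_mx C c); rewrite col_mx_sub => /andP[].
  by have := rank_ltmx lt; have := rank_leq_col (col_mx C c); lia.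
move=> i; case: (split_ordP i) => j ->; first by rewrite rowKu.
by rewrite rowKd [j]ord1 row_id.
Qed.

Lemma deg_gens p (sh : 'I_p -> int) Z e : gsubmod sh Z -> exists q (A : 'M[S]_(q, p)),
  [/\ inZ Z A, hmat sh e A & forall v, Z v -> hmat sh e v -> exists w, v = w *m A].
Proof.
move=> [[Z0 ZD ZM] _]; have [q [g sp]] := span_deg sh e.
pose dec (c : 'rV[k]_q) := map_mx (@mpolyC N k) c *m g.
have decD c d : dec (c + d) = dec c + dec d by rewrite /dec map_mxD mulmxDl.
have decZ a c : dec (a *: c) = a%:MP *: dec c by rewrite /dec map_mxZ scalemxAl.
have dec0 : dec 0 = 0 by rewrite /dec map_mx0 mul0mx.
have [|c d|a c|r [C hC]] := @subspace_basis q (fun c => Z (dec c) /\ hmat sh e (dec c)).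
- by rewrite dec0; split=> // i l; rewrite mxE; apply: homog0.
- by move=> [Zc hc] [Zd hd]; rewrite decD; split; [apply: ZD|apply: hmatD].
- move=> [Zc hc]; rewrite decZ; split; first exact: ZM.
  by move=> i l; rewrite mxE -[_ - _]add0r; apply: homogM; [apply: homogC|apply: hc].
have hrow i : Z (dec (row i C)) /\ hmat sh e (dec (row i C)).
  by apply/hC; apply: row_sub.
exists r, (\matrix_i dec (row i C)); split.
- by move=> i; rewrite rowK; case: (hrow i).
- by move=> i l; rewrite mxE; case: (hrow i) => _; apply.
move=> v Zv hv; have [c Ec] := sp _ hv.
have : (c <= C)%MS by apply/hC; rewrite /dec -Ec.
move=> /submxP[D ED]; exists (map_mx (@mpolyC N k) D).
rewrite Ec ED map_mxM -mulmxA; congr (_ *m _).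
by apply/row_matrixP => i; rewrite rowK row_mul /dec map_row.
Qed.

Lemma hproj_decomp p (sh : 'I_p -> int) (v : 'rV[S]_p) e0 : (forall l, e0 <= sh l) ->
  exists D : nat, v = \sum_(d < D) hproj sh (e0 + d%:Z) v.
Proof.
move=> le0; exists (\max_(l < p) (msize (v 0%R l) + `|sh l - e0|))%N.
set D := (\max_(l < p) _)%N.
apply/rowP => l; rewrite summxE; apply/mpolyP => m; rewrite raddf_sum /=.
under eq_bigr do rewrite mxE mcoeff_hcomp.
have [mv|] := boolP (m \in msupp (v 0 l)); last first.
  by rewrite mcoeff_msupp negbK => /eqP ->; rewrite big1 // => d _; case: ifP.
have lD : (msize (v 0%R l) + `|sh l - e0| <= D)%N.
  exact: (leq_bigmax (F := fun l => (msize (v 0%R l) + `|sh l - e0|)%N)).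
have mm := msize_mdeg_lt mv; have le := le0 l.
have dD : (mdeg m + `|sh l - e0| < D)%N by lia.
rewrite (bigD1 (Ordinal dD)) //= big1 ?addr0.
  by case: ifP => // /eqP; lia.
move=> d /eqP nd; case: eqP => // Ed; case: nd; apply: val_inj => /=; lia.
Qed.

(** Degree by degree, finitely many generators suffice up to degree [b + 1]; in higher degrees
    [star_gen] reduces to the degree below. *)
Lemma star_fg p (sh : 'I_p -> int) Z b : star sh Z b -> gsubmod sh Z ->
  (forall l, sh l <= b) -> exists q (sh' : 'I_q -> int) (A : 'M[S]_(q, p)),
  [/\ hmap sh' sh A, forall v, Z v <-> exists w, v = w *m A & forall l, sh' l <= b + 1].
Proof.
move=> st gZ leb; have [sZ projZ] := gZ.
(* Below [e0] every homogeneous vector is 0, so generators are collected from there upwards;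
   [e0 <= b] makes the number of degrees to treat a natural number. *)
have [e0 le0 e0b] : exists2 e0, forall l, e0 <= sh l & e0 <= b.
  exists (- ((\max_(l < p) `|sh l|)%:Z + `|b|%:Z)); last by lia.
  move=> l; have : (`|sh l| <= \max_(l < p) `|sh l|)%N.
    exact: (leq_bigmax (F := fun l => `|sh l|%N)).
  lia.
have low e (v : 'rV[S]_p) : e < e0 -> hmat sh e v -> v = 0.
  move=> ee0 hv; apply/rowP => l; rewrite mxE; apply: (homog_neg (hv 0 l)).
  by have := le0 l; lia.
have gens n : exists q (sh' : 'I_q -> int) (A : 'M[S]_(q, p)),
  [/\ hmap sh' sh A, inZ Z A, forall l, sh' l < e0 + n%:Z &
      forall e v, e < e0 + n%:Z -> Z v -> hmat sh e v -> exists w, v = w *m A].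
  elim: n => [|n [q [sh' [A [hA ZA ltA genA]]]]].
    exists 0%N, (fun=> 0), 0; split; [by case|by case|by case|].
    by move=> e v; rewrite addr0 => ee0 _ /(low _ _ ee0) ->; exists 0; rewrite mulmx0.
  have [q1 [B [ZB hB genB]]] := deg_gens (e0 + n%:Z) gZ.
  pose sh2 (i : 'I_(q + q1)) := match split i with inl a => sh' a | inr _ => e0 + n%:Z end.
  have sl j : sh2 (lshift q1 j) = sh' j by rewrite /sh2 (unsplitK (inl j)).
  have sr j : sh2 (rshift q j) = e0 + n%:Z by rewrite /sh2 (unsplitK (inr j)).
  exists (q + q1)%N, sh2.
  exists (col_mx A B); split.
  - move=> i l; case: (split_ordP i) => j ->.
      by rewrite col_mxEu sl; apply: hA.
    by rewrite col_mxEd sr; apply: hB.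
  - by move=> i; case: (split_ordP i) => j ->; rewrite ?rowKu ?rowKd.
  - move=> i; case: (split_ordP i) => j ->.
      by rewrite sl; have := ltA j; lia.
    by rewrite sr; lia.
  - move=> e v le Zv hv; have [lte|gee] := ltP e (e0 + n%:Z).
      have [w ->] := genA _ _ lte Zv hv; exists (row_mx w 0).
      by rewrite mul_row_col mul0mx addr0.
    have Ee : e = e0 + n%:Z by lia.
    rewrite Ee in hv; have [w ->] := genB _ Zv hv; exists (row_mx 0 w).
    by rewrite mul_row_col mul0mx add0r.
(* [gens n] reaches the degrees strictly below [e0 + n], so this value of [n] includes [b + 1]. *)
have [q [sh' [A [hA ZA ltA genA]]]] := gens (absz (b + 2 - e0)%R).
exists q, sh', A; split=> //; last by move=> l; have := ltA l; lia.
have genh n : forall e v, e <= b + 1 + n%:Z -> Z v -> hmat sh e v -> exists w, v = w *m A.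
  elim: n => [|n IH] e v le Zv hv; first by apply: (genA e) => //; lia.
  have [leb1|gtb] := leP e (b + 1); first by apply: (IH e) => //; lia.
  have [Y [ZY hY ->]] := star_gen st gZ leb gtb hv Zv.
  have [||W ->] := @lift_rows _ _ _ (fun v => Z v /\ hmat sh (e - 1) v) A Y.
  - by move=> u [Zu hu]; apply: (IH (e - 1)) => //; lia.
  - by move=> i; split=> [|j l]; [exact: ZY|rewrite mxE; exact: hY].
  by exists (row K0 (KD *m W)); rewrite mulmxA row_mul.
move=> v; split=> [Zv|[w ->]]; last first.
  rewrite mulmx_sum_row; apply: submod_sum => // j _.
  by case: sZ => _ _; apply; apply: ZA.
have [D ->] := hproj_decomp v le0.
have /fin_all_exists[w hw] : forall d : 'I_D, exists w, hproj sh (e0 + d%:Z) v = w *m A.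
  move=> d; apply: (genh d (e0 + d%:Z)); first by lia.
    exact: projZ.
  exact: hmat_hproj.
by exists (\sum_d w d); rewrite mulmx_suml; apply: eq_bigr => d _.
Qed.

End Submodules.

(** * From Koszul homology to Betti numbers *)

(** In a resolution each free module is chosen to cover the kernel left by the previous choice. *)
Lemma dependent_choice (T : Type) (P : T -> Prop) (R : T -> T -> Prop) (x0 : T) :
  P x0 -> (forall x, P x -> exists y, P y /\ R x y) ->
  exists f : nat -> T, f 0%N = x0 /\ forall i, R (f i) (f i.+1).
Proof.
move=> Px0 step.
pose next (x : {x | P x}) := constructive_indefinite_description _ (step (sval x) (svalP x)).
pose nx (x : {x | P x}) : {x | P x} := exist _ (sval (next x)) (proj1 (svalP (next x))).
exists (fun i => sval (iter i nx (exist _ x0 Px0))); split=> // i.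
exact: (proj2 (svalP (next (iter i nx (exist _ x0 Px0))))).
Qed.

Section Regularity.

Variables (k : fieldType) (N : nat).
Local Notation S := {mpoly k[N]}.
Local Notation KD := (@KD k N).
Local Notation K0 := (@K0 k N).
Variables (I : S -> Prop) (r : nat).
Hypotheses (hI : hideal I) (rI : regle I r).

Let idI : ideal I. Proof. by case: hI. Qed.

Lemma homog_shift (a b : int) (f : S) :
  (forall m, m \in msupp f -> b + (mdeg m)%:Z = a) <-> homogeneous (a - b) f.
Proof. by split=> h m /h; lia. Qed.

Definition syz (F : gseq k N) (i : nat) : 'rV[S]_(grank F i) -> Prop :=
  match i with
  | 0 => fun v => I ((v *m gaug F) 0 0)
  | i'.+1 => fun v => v *m gdiff F i' = 0
  end.

Section Resolution.

Variable F : gseq k N.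
Hypothesis resF : graded_free_resolution I F.

Let hA i : hmap (gshift (i:=i.+1)) (gshift (i:=i)) (gdiff F i).
Proof. by case: resF => [[h _] _] a b; apply/homog_shift => m; apply: h. Qed.

Let ha : hmap (gshift (i:=0)) sh0 (gaug F).
Proof.
case: resF => [[_ h] _] a b; apply/homog_shift => m.
by rewrite [b]ord1 => /h ->; rewrite /sh0 add0r.
Qed.

Let im i v : syz v <-> exists w, v = w *m gdiff F i.
Proof. by case: resF => _ [_ h0 h1]; case: i v => [|i] v; [apply: h0|apply: h1]. Qed.

Let sur f : exists v : 'rV_(grank F 0), I (f - (v *m gaug F) 0 0).
Proof. by case: resF => _ [h _ _]; apply: h. Qed.

Lemma star_syz i : star (gshift (i:=i)) (@syz F i) (r%:Z + i%:Z).
Proof.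
elim: i => [|i IH].
  by rewrite addr0 => e y re hy _; apply: (star_base hI rI ha sur).
by rewrite -addn1 PoszD addrA addn1; apply: (star_ker IH (@hA i) (@im i)).
Qed.

Let row_KD0 m (y : 'M[S]_(_, m)) l : ((KD *m y) K0 l)@_0%MM = 0.
Proof.
rewrite mxE raddf_sum big1 // => j _ /=.
have := homog_mcoeff0 (@KD_homog k N K0 j).
by rewrite (rmorphM (mcoeff 0%MM)) /= => ->; rewrite ?mul0r.
Qed.

(** Lift [c] to a vector [v] of constants in exterior degree 0. The zigzag gives [y'] such that [v]
    minus the [K0] row of [K y'] is a syzygy, hence an image from [F_(i+1)]. That row has no
    constant terms, so modulo the variables [v] itself is such an image. *)
Lemma tor_zero i j (c : 'rV[k]_(grank F i)) : r%:Z < j - i%:Z ->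
  (c <= tensor_cycles F i j)%MS -> (c <= tensor_boundaries F i j)%MS.
Proof.
move=> rj cyc.
have part : (c <= tensor_part F i j)%MS.
  by case: (i) c cyc => [|i'] c //; rewrite sub_capmx => /andP[].
have supp l : gshift l != j -> c 0 l = 0.
  move=> /negbTE neq; have /submxP[D ->] := part.
  by rewrite mul_mx_diag !mxE neq mulr0.
have [v Ev] : exists v, v = map_mx (@mpolyC N k) c by exists (map_mx (@mpolyC N k) c).
have hv : hmat (gshift (i:=i)) j v.
  move=> a l; rewrite Ev [a]ord1 mxE; have [->|/supp ->] := eqVneq (gshift l) j.
    by rewrite subrr; apply: homogC.
  by rewrite mpolyC0; apply: homog0.
suff [u hu] : exists u : 'rV[S]_(grank F i.+1), forall l, (v 0 l)@_0%MM = ((u *m gdiff F i) 0 l)@_0%MM.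
  (* In the degree [j] part, a constant term can occur only at basis elements of shift [j], so the
     reduction of [u'] lies in [tensor_part]. *)
  pose u' := hproj (gshift (i:=i.+1)) j u.
  have hu' l : (v 0 l)@_0%MM = ((u' *m gdiff F i) 0 l)@_0%MM.
    rewrite -(hproj_mulr _ _ (@hA i)) [in RHS]mxE mcoeff_hcomp mdeg0.
    have [E|neq] := eqVneq (gshift l) j; first by rewrite E subrr eqxx hu.
    by rewrite Ev mxE supp // mpolyC0 mcoeff0 [0 == _]eq_sym subr_eq0 eq_sym (negbTE neq).
  apply/submxP; exists (map_mx (mcoeff 0%MM) u').
  have -> : map_mx (mcoeff 0%MM) u' *m tensor_boundaries F i j =
            map_mx (mcoeff 0%MM) u' *m tensor_diff F i.
    rewrite mulmxA; congr (_ *m _); apply/rowP => l; rewrite mul_mx_diag !mxE.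
    rewrite mcoeff_hcomp mdeg0; have [->|neq] := eqVneq (gshift l) j; first by rewrite mulr1.
    by rewrite eq_sym subr_eq0 eq_sym (negbTE neq) mul0r.
  rewrite -map_mxM; apply/rowP => l; rewrite [RHS]mxE /= -hu' Ev mxE mcoeffC eqxx mulr1 //.
have [y' Ey'] : exists y', syz (row K0 (erow K0 v - KD *m y')).
  case: (i) c cyc part supp v Ev hv rj => [|i'] c cyc part supp v Ev hv rj.
    have [|i0|y' [hy' Zy']] := star_base hI rI ha sur (e := j) (y := erow K0 v) _ (hmat_erow hv).
    - by move: rj; rewrite subr0.
    - by rewrite KD_erow row0 /= mul0mx mxE; case: idI.
    by exists y'; apply: Zy'.
  have [|l||y' [hy' Zy']] := star_step (@star_syz i') (@hA i') (@im i') (e := j) (y := erow K0 v) _ (hmat_erow hv).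
  - by move: rj; lia.
  - have -> : (erow K0 v *m gdiff F i') K0 l = (v *m gdiff F i') 0 l.
      by rewrite -[in RHS](row_erow K0 v) -row_mul [in RHS]mxE.
    move: cyc; rewrite sub_capmx => /andP[_ /sub_kermxP].
    move=> /rowP/(_ l); rewrite [RHS]mxE => <-; rewrite !mxE raddf_sum; apply: eq_bigr => a _.
    by rewrite Ev !mxE; exact: mcoeffCM.
  - by rewrite KD_erow mul0mx.
  by exists y'; rewrite /= -row_mul Zy' row0.
have [u Eu] := (@im i _).1 Ey'.
exists u => l; have -> : u *m gdiff F i = v - row K0 (KD *m y').
  by rewrite -Eu linearB /= row_erow.
have row0 : ((row K0 (KD *m y')) 0 l)@_0%MM = 0 by rewrite mxE row_KD0.
by rewrite [in RHS]mxE mcoeffD [in X in _ + X]mxE mcoeffN row0 oppr0 addr0.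
Qed.

Lemma tensor_homology_zero i j : r%:Z < j - i%:Z -> tensor_homology_dim F i j = 0%N.
Proof.
move=> rj; apply/eqP; rewrite subn_eq0; apply: mxrankS; apply/row_subP => a.
by apply: tor_zero => //; apply: row_sub.
Qed.

End Resolution.

(** * Construction of a graded free resolution, and existence of the regularity *)

Record gstate := GState {
  gs_p : nat;
  gs_sh : 'I_gs_p -> int;
  gs_Z : 'rV[S]_gs_p -> Prop;
  gs_b : int }.

Definition good s :=
  [/\ gsubmod (@gs_sh s) (@gs_Z s), star (@gs_sh s) (@gs_Z s) (gs_b s) &
      forall l, @gs_sh s l <= gs_b s].

(** The image of [A] is the old submodule and its kernel is the new one: exactness at the smaller
    module together with the datum for the next step. *)
Definition linked s s' (A : 'M[S]_(gs_p s', gs_p s)) :=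
  [/\ hmap (@gs_sh s') (@gs_sh s) A, forall v, @gs_Z s v <-> exists w, v = w *m A
    & forall v, @gs_Z s' v <-> v *m A = 0].

Lemma good_step s : good s -> exists s', good s' /\ exists A, @linked s s' A.
Proof.
move=> [gZ st le]; have [q [sh' [A [hA im le']]]] := star_fg st gZ le.
exists (@GState q sh' (fun v => v *m A = 0) (gs_b s + 1)); split; last by exists A.
split=> //=; last exact: star_ker st hA im.
split; first split.
- by rewrite mul0mx.
- by move=> u v Eu Ev; rewrite mulmxDl Eu Ev addr0.
- by move=> c v Ev; rewrite -scalemxAl Ev scaler0.
- by move=> e v Ev; rewrite -(hproj_mulr _ _ hA) Ev; apply/rowP => l; rewrite !mxE hcomp0.
Qed.

(** The last two conclusions serve to show that [beta_{0,0}] is nonzero: a basis element of degree 0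
    survives in [F_0] tensored with [k] when the first differential has no constant terms. *)
Lemma resolution_exists : exists F : gseq k N, [/\ graded_free_resolution I F,
  exists l : 'I_(grank F 0), gshift l = 0 &
  forall i l, (forall f, I f -> f@_0%MM = 0) -> (gdiff F 0 i l)@_0%MM = 0].
Proof.
pose Z0 := (fun v : 'rV[S]_1 => I (v 0 0)).
pose s0 := @GState 1 (fun=> 0) Z0 r%:Z.
have g0 : good s0.
  split=> //=; first split; first split.
  - by rewrite /Z0 mxE; case: idI.
  - by move=> u v Zu Zv; rewrite /Z0 mxE; apply: ideal_add.
  - by move=> c v Zv; rewrite /Z0 mxE; apply: ideal_mull.
  - by move=> e v Zv; rewrite /Z0 mxE; case: hI => _; apply.
  move=> e y re hy _ Dy; have [|w [hw yw]] := rI re hy.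
    by move=> i l; have := Dy i; rewrite /Z0 [l]ord1 mxE.
  by exists w; split=> // i; rewrite /Z0 mxE; apply: yw.
have [f [f0 hf]] := dependent_choice g0 good_step.
pose A i : 'M_(gs_p (f i.+1), gs_p (f i)) :=
  sval (constructive_indefinite_description _ (hf i)).
have LA i : linked (A i) := svalP (constructive_indefinite_description _ (hf i)).
(* [f 0 = s0] is only a propositional equation; packing the augmentation with all its properties
   lets it be rewritten once, inside the existential. *)
have [a [l [ha aZ sur hl Z0m]]] : exists (a : 'cV[S]_(gs_p (f 0%N))) (l : 'I_(gs_p (f 0%N))),
    [/\ hmap (@gs_sh (f 0%N)) sh0 a,
        forall v, @gs_Z (f 0%N) v <-> I ((v *m a) 0 0),
        forall g, exists v : 'rV_(gs_p (f 0%N)), I (g - (v *m a) 0 0), gs_sh l = 0 &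
        forall v, @gs_Z (f 0%N) v -> (forall g, I g -> g@_0%MM = 0) -> forall l, (v 0 l)@_0%MM = 0].
  rewrite f0; exists 1%:M, ord0; split=> //=.
  - move=> a b; rewrite [a]ord1 [b]ord1 mxE eqxx /= /sh0 subr0 -mpolyC1; exact: homogC.
  - by move=> v; rewrite mulmx1.
  - by move=> g; exists (const_mx g); rewrite mulmx1 mxE subrr; case: idI.
  - by move=> v Zv Im l; rewrite [l]ord1; apply: Im.
exists (@GSeq k N (fun i => gs_p (f i)) (fun i => @gs_sh (f i)) A a); split.
- split; split=> /=.
  + by move=> i x b m; move: m; apply/homog_shift; case: (LA i) => h _ _; apply: h.
  + by move=> x m mx; have := ha x 0; rewrite subr0; apply.
  + exact: sur.
  + by move=> v; rewrite -aZ; case: (LA 0%N).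
  + move=> i v; case: (LA i) => _ _ <-; by case: (LA i.+1).
- by exists l.
- move=> i b Im /=; have -> : A 0%N i b = row i (A 0%N) 0 b by rewrite mxE.
  apply: Z0m => //; case: (LA 0%N) => _ im _; apply/im.
  by exists (delta_mx 0 i); rewrite -rowE.
Qed.

Lemma bounded_max (P : nat -> Prop) b : P 0%N -> (forall n, P n -> (n <= b)%N) ->
  exists2 m, P m & forall n, P n -> (n <= m)%N.
Proof.
move=> P0; elim: b => [|b IH] hb; first by exists 0%N.
have [Pb|nPb] := classic (P b.+1); first by exists b.+1.
apply: IH => n Pn; have := hb n Pn; rewrite leq_eqVlt => /orP[/eqP En|//].
by rewrite En in Pn.
Qed.

(** The maximum exists because the differences [j - i] are bounded by [r] and 0 occurs among them,
    from [beta_{0,0}]. Negative differences can then be ignored, so the search is over natural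
    numbers. *)
Theorem regularity_le : (forall f, I f -> f@_0%MM = 0) ->
  exists rho, regularity I rho /\ rho <= r%:Z.
Proof.
move=> Im.
have bound i j b : betti I i j b -> b <> 0%N -> j - i%:Z <= r%:Z.
  move=> [F [resF <-]] nz; rewrite leNgt; apply/negP => lt.
  by apply: nz; apply: tensor_homology_zero.
pose P n := exists i j b, [/\ betti I i j b, b <> 0%N & n%:Z = j - i%:Z].
have [||m Pm hm] := @bounded_max P r.
- have [F [resF [l hl] d0]] := resolution_exists.
  exists 0%N, 0, (tensor_homology_dim F 0 0); split=> //; first by exists F.
  rewrite /tensor_homology_dim /tensor_boundaries.
  have -> : tensor_diff F 0 = 0 by apply/matrixP => i b; rewrite !mxE d0.
  rewrite mulmx0 mxrank0 subn0 => /eqP; rewrite mxrank_eq0 => /eqP/matrixP/(_ l l)/eqP.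
  by rewrite !mxE eqxx hl eqxx oner_eq0.
- move=> n [i [j [b [hb nz En]]]]; rewrite -lez_nat En; exact: (bound _ _ _ hb nz).
exists m%:Z; split; last by case: Pm => i [j [b [hb nz ->]]]; apply: (bound _ _ _ hb nz).
split=> // i j b hb nz.
have [neg|pos] := ltP (j - i%:Z) 0; first by lia.
have : P (absz (j - i%:Z)%R) by exists i, j, b; split=> //; lia.
by move/hm; lia.
Qed.

End Regularity.

(** * Binomial edge ideals *)

Section VariableIdeals.

Variables (k : fieldType) (N : nat).
Local Notation S := {mpoly k[N]}.
Implicit Types (G H : S -> Prop) (U : {set 'I_N}).

Lemma idl_eq G H : (forall g, G g -> idl H g) -> (forall g, H g -> idl G g) ->
  forall f, idl G f <-> idl H f.
Proof. by move=> GH HG f; split; apply: idl_sub. Qed.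

Lemma idl_gUCA G1 G2 G3 f : idl (gU G1 (gU G2 G3)) f <-> idl (gU G2 (gU G1 G3)) f.
Proof.
by apply: idl_eq => g [h|[h|h]]; apply: idl_gen;
  [right; left|left|right; right|right; left|left|right; right].
Qed.

Lemma homG_gX U : homG (@gX k N U).
Proof. by move=> g [i _ ->]; exists 1; apply: homogX. Qed.

Lemma homG_gP i : homG (gP ('X_i : S)).
Proof. by move=> g ->; exists 1; apply: homogX. Qed.

Lemma gfree_gX U U' : [disjoint U & U'] -> gfree U (@gX k N U').
Proof.
move=> dis g [i iU ->]; rewrite killX; case: ifP => // iU'.
by rewrite (disjointFr dis iU') in iU.
Qed.

Lemma gfree_gP U i : i \notin U -> gfree U (gP ('X_i : S)).
Proof. by move=> /negbTE niU g ->; rewrite killX niU. Qed.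

Lemma idl_addX i G f : addX 'X_i (idl G) f <-> idl (gU (gP 'X_i) G) f.
Proof.
split=> [[c [b [Gb ->]]]|/idl_gPU[c [b [Gb ->]]]]; last by exists c, b; rewrite mulrC.
apply: ideal_add (idl_ideal _) _ (idl_Ur _ Gb).
by rewrite mulrC; apply: idl_Ul; apply: idl_gPM.
Qed.

Lemma regle_gP i G r : homG G -> gfree [set i] G -> regle (idl G) r ->
  regle (idl (gU (gP 'X_i) G)) r.
Proof.
move=> hG fG rG; apply: (regle_ext (@idl_addX i G)).
by apply: regle_addX => //; [apply: idl_hideal|apply: nzd_gfree].
Qed.

(** The variables are added one at a time, each being a nonzerodivisor modulo an ideal generated
    without it. *)
Lemma regle_gX U G r : homG G -> gfree U G -> regle (idl G) r ->
  regle (idl (gU (gX U) G)) r.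
Proof.
move=> hG; move: {2}#|U| (erefl #|U|) => n; elim: n U => [|n IH] U.
  move=> /cards0_eq -> _; apply: regle_ext => f; apply: idl_eq => g.
    by move=> Gg; apply: idl_gen; right.
  by case=> [[i]|]; [rewrite inE|apply: idl_gen].
move=> cU fG rG; have /card_gt0P[i iU] : (0 < #|U|)%N by rewrite cU.
have cU' : #|U :\ i| = n by have := cardsD1 i U; rewrite iU cU; lia.
have sU : U :\ i \subset U by apply: subsetDl.
apply: (regle_ext (I := idl (gU (gP 'X_i) (gU (gX (U :\ i)) G)))).
  apply: idl_eq => g.
    case=> [->|[[j]|Gg]]; [|rewrite inE => /andP[_ jU] ->|]; apply: idl_gen.
    - by left; exists i.
    - by left; exists j.
    - by right.
  case=> [[j jU ->]|Gg]; apply: idl_gen; last by right; right.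
  have [->|neq] := eqVneq j i; first by left.
  by right; left; exists j; rewrite // !inE neq.
apply: regle_gP.
- by apply: homG_U => //; apply: homG_gX.
- apply: gfree_U; last by apply: gfree_sub fG; rewrite sub1set.
  by apply: gfree_gX; rewrite disjoints1 !inE eqxx.
- by apply: IH => //; apply: gfree_sub fG.
Qed.

Lemma idl_kill_gX U G f : gfree U G -> idl (gU (gX U) G) f -> idl G (kill U f).
Proof.
move=> fG; apply: idl_rmorph => g [[i iU ->]|Gg] /=.
  by rewrite killX iU; apply: idl0.
by rewrite fG //; apply: idl_gen.
Qed.

End VariableIdeals.

(** * Binomial edge ideals of complete graphs, disjoint unions and joins *)

Section BinomialIdeals.

Variables (k : fieldType) (n : nat).
Local Notation S := {mpoly k[n + n]}.
Local Notation x := (@xvar k n).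
Local Notation y := (@yvar k n).
Implicit Types (V : {set 'I_n}) (B : S -> Prop) (e : rel 'I_n).

Definition fm i j : S := x i * y j - y i * x j.

Definition vset V : {set 'I_(n + n)} := [set t | match split t with inl i => i \in V | inr i => i \in V end].

Lemma lshift_vset V i : (lshift n i \in vset V) = (i \in V).
Proof. by rewrite inE (unsplitK (inl i)). Qed.

Lemma rshift_vset V i : (rshift n i \in vset V) = (i \in V).
Proof. by rewrite inE (unsplitK (inr i)). Qed.

Lemma vsetP V t : t \in vset V -> exists2 i, i \in V & t = lshift n i \/ t = rshift n i.
Proof.
case: (split_ordP t) => i ->; rewrite ?lshift_vset ?rshift_vset => iV; exists i => //.
  by left.
by right.
Qed.

Lemma vsetS V V' : V \subset V' -> vset V \subset vset V'.
Proof.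
by move=> /subsetP sV; apply/subsetP => t /vsetP[i /sV iV [->|->]];
  rewrite ?lshift_vset ?rshift_vset.
Qed.

Lemma vset_disjoint V V' : [disjoint V & V'] -> [disjoint vset V & vset V'].
Proof.
move=> dis; apply/pred0P => t /=; apply/negP => /andP[/vsetP[i iV [->|->]]];
  by rewrite ?lshift_vset ?rshift_vset (disjointFr dis iV).
Qed.

Definition gK V g := exists i j, [/\ i \in V, j \in V & g = fm i j].
Definition gE e V g := exists i j, [/\ i \in V, j \in V, e i j & g = fm i j].
Definition gV V : S -> Prop := gX (vset V).

Lemma fm_homog i j : homogeneous 2 (fm i j).
Proof. by apply: homogB; rewrite -[2]/(1 + 1)%Z; apply: homogM; apply: homogX. Qed.

Lemma homG_gK V : homG (gK V).
Proof. by move=> g [i [j [_ _ ->]]]; exists 2; apply: fm_homog. Qed.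

Lemma homG_gE e V : homG (gE e V).
Proof. by move=> g [i [j [_ _ _ ->]]]; exists 2; apply: fm_homog. Qed.

Lemma homG_gV V : homG (gV V). Proof. exact: homG_gX. Qed.

Lemma kill_fm (U : {set 'I_(n + n)}) i j : lshift n i \notin U -> rshift n i \notin U ->
  lshift n j \notin U -> rshift n j \notin U -> kill U (fm i j) = fm i j.
Proof.
move=> /negbTE a /negbTE b /negbTE c /negbTE d.
by rewrite rmorphB !rmorphM /= !killX a b c d.
Qed.

Lemma gfree_gK (U : {set 'I_(n + n)}) V : [disjoint U & vset V] -> gfree U (gK V).
Proof.
move=> dis g [i [j [iV jV ->]]]; apply: kill_fm;
  by rewrite (disjointFl dis) ?lshift_vset ?rshift_vset.
Qed.

Lemma gE_gK e V g : gE e V g -> gK V g.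
Proof. by move=> [i [j [iV jV _ ->]]]; exists i, j. Qed.

Lemma gfree_gE (U : {set 'I_(n + n)}) e V : [disjoint U & vset V] -> gfree U (gE e V).
Proof. by move=> dis g /gE_gK; apply: gfree_gK. Qed.

Lemma fmC i j : fm i j = - fm j i. Proof. rewrite /fm; ring. Qed.
Lemma fmii i : fm i i = 0. Proof. rewrite /fm; ring. Qed.

Lemma gV_x V i : i \in V -> gV V (x i).
Proof. by move=> iV; exists (lshift n i) => //; rewrite lshift_vset. Qed.

Lemma gV_y V i : i \in V -> gV V (y i).
Proof. by move=> iV; exists (rshift n i) => //; rewrite rshift_vset. Qed.

Lemma gV_fml V i j : i \in V -> idl (gV V) (fm i j).
Proof.
move=> iV; rewrite /fm; apply: ideal_sub (idl_ideal _) _ _.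
  by apply: ideal_mulr (idl_ideal _) _; apply: idl_gen; apply: gV_x.
by apply: ideal_mulr (idl_ideal _) _; apply: idl_gen; apply: gV_y.
Qed.

Lemma gV_fmr V i j : j \in V -> idl (gV V) (fm i j).
Proof. by move=> jV; rewrite fmC; apply: ideal_opp (idl_ideal _) _; apply: gV_fml. Qed.

Lemma gK_gV V g : gK V g -> idl (gV V) g.
Proof. by move=> [i [j [iV _ ->]]]; apply: gV_fml. Qed.

(* Over the subring without [x_v], the relation [x_v h = q + \sum_i c_i f_{iv}]
   forces [\sum_i c_i x_i] into the ideal of [V :\ v]; the same then holds for
   [\sum_i c_i y_i] as [x_u y_i = y_u x_i] modulo that ideal and, by induction,
   [x_u] is a nonzerodivisor. *)
Lemma nzd_gK V B v : gfree (vset V) B -> v \in V -> nzd (x v) (idl (gU (gK V) B)).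
Proof.
move: {2}#|V| (erefl #|V|) => m; elim: m V v => [|m IH] V v cV fB vV.
  by move: vV; rewrite (cards0_eq cV) inE.
set V' := V :\ v; have sV' : V' \subset V by apply: subsetDl.
have cV' : #|V'| = m by have := cardsD1 v V; rewrite vV cV -/V'; lia.
set J' := idl (gU (gK V') B).
have idJ' : ideal J' by apply: idl_ideal.
have idJ := idl_ideal (gU (gK V) B).
have J'J f : J' f -> idl (gU (gK V) B) f.
  apply: idl_sub => g [[i [j [iV jV ->]]]|Bg]; apply: idl_gen; last by right.
  by left; exists i, j; split=> //; apply: (subsetP sV').
have fB' : gfree (vset V') B by apply: gfree_sub fB; apply: vsetS.
have fv t : t \in vset [set v] -> gfree [set t] (gU (gK V') B).
  move=> tv; apply: gfree_U.
    apply: gfree_gK; rewrite disjoints1; apply/negP => tV'.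
    have /pred0P/(_ t) : [disjoint vset [set v] & vset V'].
      by apply: vset_disjoint; rewrite disjoints1 !inE eqxx.
    by rewrite /= tv tV'.
  apply: gfree_sub fB; rewrite sub1set; move: tv; apply/subsetP/vsetS.
  by rewrite sub1set.
have fxv : gfree [set lshift n v] (gU (gK V') B) by apply: fv; rewrite lshift_vset inE.
have fyv : gfree [set rshift n v] (gU (gK V') B) by apply: fv; rewrite rshift_vset inE.
move=> h Jh.
have [q [s [Jq [c Es] Eh]]] : exists q s, [/\ J' q,
    exists c : 'I_n -> S, s = \sum_(i in V') c i * fm i v & x v * h = q + s].
  have : idl (gU (fun g => exists2 i, i \in V' & g = fm i v) (gU (gK V') B)) (x v * h).
    apply: idl_sub Jh => g [[i [j [iV jV ->]]]|Bg]; last by apply: idl_gen; right; right.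
    have [->|niv] := eqVneq i v; have [->|njv] := eqVneq j v.
    - by rewrite fmii; apply: idl0.
    - rewrite fmC; apply: ideal_opp (idl_ideal _) _; apply: idl_gen; left; exists j => //.
      by rewrite !inE njv.
    - by apply: idl_gen; left; exists i; rewrite // !inE niv.
    - by apply: idl_gen; right; left; exists i, j; rewrite !inE niv njv.
  by move=> /idl_gU[s [q [/idl_family[c Ec] Jq ->]]]; exists q, s; split=> //; [exists c|ring].
pose tau : S -> S := kill [set lshift n v].
have [q' Jq' Eq] := idl_divX fxv Jq.
have /fin_all_exists[c' Ec'] : forall i, exists c', c i = tau (c i) + x v * c'.
  move=> i; have [c' Ec] := gX1 (sub_kill [set lshift n v] (c i)).
  by exists c'; rewrite -Ec addrC subrK.
pose s1 := \sum_(i in V') tau (c i) * x i; pose s2 := \sum_(i in V') tau (c i) * y i.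
pose s3 := \sum_(i in V') c' i * fm i v.
have Es' : s = y v * s1 - x v * s2 + x v * s3.
  rewrite Es !mulr_sumr -sumrB -big_split /=; apply: eq_bigr => i _.
  rewrite {1}Ec' /fm; ring.
have nv i : i \in V' -> i != v by rewrite !inE => /andP[].
have taux i : i != v -> tau (x i) = x i.
  by move=> niv; rewrite /tau killX inE (inj_eq (@lshift_inj _ _)) (negbTE niv).
have tauy i : tau (y i) = y i.
  by rewrite /tau killX inE eq_sym eq_lrshift.
have tautau f : tau (tau f) = tau f by rewrite /tau kill_kill setUid.
have tau_xv : tau (x v) = 0 by rewrite /tau killX inE eqxx.
have taus1 : tau s1 = s1.
  rewrite /s1 {1}/tau rmorph_sum; apply: eq_bigr => i /nv niv.
  by rewrite rmorphM /= -!/(tau _) tautau taux.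
have t0 : tau q + y v * s1 = 0.
  have : tau (x v * h) = tau q + y v * s1.
    rewrite Eh Es' Eq /tau !(rmorphD, rmorphN, rmorphM) /= -/tau tau_xv tautau tauy !mul0r.
    by rewrite oppr0 !addr0 taus1.
  by rewrite /tau rmorphM /= -/tau tau_xv mul0r.
have Eh' : h = q' - s2 + s3.
  apply: (mulfI (mpolyX_neq0 k (lshift n v))); rewrite -/(x v) Eh Es'.
  rewrite (_ : q = tau q + x v * q') // -[RHS]add0r -t0; ring.
have Js1 : J' s1.
  apply: (nzd_gfree fyv); rewrite -/(y v).
  have -> : y v * s1 = - tau q by apply/eqP; rewrite -addr_eq0 addrC t0.
  by apply: ideal_opp => //; apply: idl_kill.
have Js2 : J' s2.
  have [V0|[u uV']] := set_0Vmem V'.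
    by rewrite /s2 V0 big_set0; case: idJ'.
  apply: (IH V' u) => //; rewrite -/J'.
  rewrite (_ : x u * s2 = \sum_(i in V') tau (c i) * fm u i + y u * s1).
    apply: ideal_add => //; last exact: ideal_mull.
    apply: ideal_sum => // i iV'; apply: ideal_mull => //; apply: idl_gen; left.
    by exists u, i.
  rewrite !mulr_sumr -big_split /=; apply: eq_bigr => i _; rewrite /fm; ring.
rewrite Eh'; apply: ideal_add => //; first by apply: ideal_sub => //; apply: J'J.
apply: ideal_sum => // i iV'; apply: ideal_mull => //; apply: idl_gen; left.
by exists i, v; split=> //; apply: (subsetP sV').
Qed.

(** The bound does not grow with [V]. After adding [x_v], the two intersected ideals have bounds
    [r + 1] (by induction, with [x_v] and [y_v] put into [B]) and [r]; their sum is generated by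
    [y_v], the [x_i] and [B] and has bound [r], so the intersection has bound [r + 1] again. *)
Lemma regle_gK V B r : homG B -> gfree (vset V) B -> regle (idl B) r ->
  regle (idl (gU (gK V) B)) r.+1.
Proof.
move: {2}#|V| (erefl #|V|) => m; elim: m V B => [|m IH] V B cV hB fB rB.
  apply: (regle_mono (leqnSn r)); apply: regle_ext rB => f; apply: idl_eq => g.
    by move=> Bg; apply: idl_gen; right.
  case=> [[i [j []]]|]; last exact: idl_gen.
  by rewrite (cards0_eq cV) inE.
have /card_gt0P[v vV] : (0 < #|V|)%N by rewrite cV.
set V' := V :\ v; have sV' : V' \subset V by apply: subsetDl.
have cV' : #|V'| = m by have := cardsD1 v V; rewrite vV cV -/V'; lia.
pose B' := gU (gP (x v)) (gU (gP (y v)) B).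
pose XV := [set lshift n i | i in V].
have XVx i : (lshift n i \in XV) = (i \in V) by rewrite (mem_imset _ _ (@lshift_inj _ _)).
have XVy i : rshift n i \notin XV.
  by apply/imsetP => -[j _ /eqP]; rewrite eq_sym eq_lrshift.
have sXV : XV \subset vset V.
  by apply/subsetP => t /imsetP[i iV ->]; rewrite lshift_vset.
have fxB : gfree [set lshift n v] B.
  by apply: gfree_sub fB; rewrite sub1set lshift_vset.
have fyB : gfree [set rshift n v] B.
  by apply: gfree_sub fB; rewrite sub1set rshift_vset.
have hB' : homG B' by do 2![apply: homG_U; first exact: homG_gP].
apply: (regle_subX (i := lshift n v)).
- by apply: idl_hideal; apply: homG_U => //; apply: homG_gK.
- exact: nzd_gK.
apply: (regle_ext (I := iint (idl (gU (gK V') B')) (idl (gU (gX XV) B)))).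
  move=> f; rewrite idl_addX -/(x v).
  set L := idl (gU (gP (x v)) _); have idL : ideal L by apply: idl_ideal.
  have Lxv : L (x v) by apply: idl_gen; left.
  split=> [[A1 A2]|Lf]; last split.
  (* Write [f = c1 x_v + c2 y_v + g2] with [g2] in the ideal of [V'] and [B]. Membership in the
     second ideal gives [y_v c2], hence [c2], in the ideal of the [x_i] and [B]; finally
     [y_v x_i = y_i x_v + f_iv] brings [c2 y_v] into the sum. *)
  - move/idl_gUCA: A1 => /idl_gPU[c1 [g1 [/idl_gUCA/idl_gPU[c2 [g2 [A1 Eg1]]] Ef]]].
    have Lg2 : L g2.
      apply: idl_sub A1 => g [[i [j [iV jV ->]]]|Bg]; apply: idl_gen; right; last by right.
      by left; exists i, j; split=> //; apply: (subsetP sV').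
    have Lc1 : L (c1 * x v) by apply: ideal_mull.
    rewrite Ef; apply: ideal_add => //; rewrite Eg1; apply: ideal_add => //.
    have idA2 := idl_ideal (gU (gX XV) B).
    have A2x i : i \in V -> idl (gU (gX XV) B) (x i).
      by move=> iV; apply: idl_gen; left; exists (lshift n i); rewrite ?XVx.
    have A2g2 : idl (gU (gX XV) B) g2.
      apply: idl_sub A1 => g [[i [j [iV jV ->]]]|Bg]; last by apply: idl_gen; right.
      apply: ideal_sub => //; [apply: ideal_mulr => //|apply: ideal_mull => //]; apply: A2x;
        by apply: (subsetP sV').
    have : idl (gU (gX XV) B) (y v * c2).
      have -> : y v * c2 = f - c1 * x v - g2 by rewrite Ef Eg1; ring.
      by do 2![apply: ideal_sub => //]; apply: ideal_mull => //; apply: A2x.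
    have /nzd_gfree nz : gfree [set rshift n v] (gU (gX XV) B).
      by apply: gfree_U => //; apply: gfree_gX; rewrite disjoints1.
    move=> /nz A2c2; rewrite mulrC.
    move: c2 {Eg1} A2c2; apply: idl_ind => [|c g g' [[t /imsetP[i iV ->] ->]|Bg] _ Lg'].
    + by rewrite mulr0; case: idL.
    + rewrite mulrDr mulrCA; apply: ideal_add => //; apply: ideal_mull => //.
      rewrite (_ : _ * _ = y i * x v + fm i v); last by rewrite /fm /x; ring.
      apply: ideal_add => //; first exact: ideal_mull.
      by apply: idl_gen; right; left; exists i, v.
    + rewrite mulrDr mulrCA; apply: ideal_add => //; do 2![apply: ideal_mull => //].
      by apply: idl_gen; right; right.
  - apply: idl_sub Lf => g [->|[[i [j [iV jV ->]]]|Bg]]; last by apply: idl_gen; right; right; right.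
      by apply: idl_gen; right; left.
    have xv' : idl (gU (gK V') B') (x v) by apply: idl_gen; right; left.
    have yv' : idl (gU (gK V') B') (y v) by apply: idl_gen; right; right; left.
    have idA := idl_ideal (gU (gK V') B').
    have [->|niv] := eqVneq i v; first by apply: ideal_sub => //; apply: ideal_mulr.
    have [->|njv] := eqVneq j v; first by apply: ideal_sub => //; apply: ideal_mull.
    by apply: idl_gen; left; exists i, j; rewrite !inE niv njv.
  - have A2x i : i \in V -> idl (gU (gX XV) B) (x i).
      by move=> iV; apply: idl_gen; left; exists (lshift n i); rewrite ?XVx.
    have idA := idl_ideal (gU (gX XV) B).
    apply: idl_sub Lf => g [->|[[i [j [iV jV ->]]]|Bg]]; [exact: A2x| |by apply: idl_gen; right].
    by apply: ideal_sub => //; [apply: ideal_mulr => //|apply: ideal_mull => //]; apply: A2x.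
apply: regle_int.
- by apply: idl_hideal; apply: homG_U => //; apply: homG_gK.
- by apply: idl_hideal; apply: homG_U => //; apply: homG_gX.
- apply: IH => //.
    do 2![apply: gfree_U; first by apply: gfree_gP; rewrite ?lshift_vset ?rshift_vset !inE eqxx].
    by apply: gfree_sub fB; apply: vsetS.
  apply: regle_gP; first by apply: homG_U => //; apply: homG_gP.
    by apply: gfree_U => //; apply: gfree_gP; rewrite inE eq_sym eq_lrshift.
  exact: regle_gP.
- by apply: (regle_mono (leqnSn r)); apply: regle_gX => //; apply: gfree_sub fB.
- apply: (regle_ext (I := idl (gU (gX (rshift n v |: XV)) B))); last first.
    apply: regle_gX => //; apply: gfree_sub fB.
    by rewrite subUset sub1set rshift_vset vV.
  move=> f; rewrite -idl_gU; move: f; apply: idl_eq => g.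
    case=> [[t /setU1P[->|tX] ->]|Bg]; apply: idl_gen.
    + by left; right; right; left.
    + by right; left; exists t.
    + by right; right.
  pose G3 := gU (gX (rshift n v |: XV)) B; rewrite -/G3.
  have G3y : idl G3 (y v) by apply: idl_gen; left; exists (rshift n v); rewrite ?setU11.
  have G3x i : i \in V -> idl G3 (x i).
    by move=> iV; apply: idl_gen; left; exists (lshift n i) => //; rewrite setU1r ?XVx.
  have G3B h : B h -> idl G3 h by move=> Bh; apply: idl_gen; right.
  have id3 := idl_ideal G3.
  case=> [[[i [j [iV jV ->]]]|[->|[->|Bg]]]|[[t tX ->]|Bg]]; try exact: G3B.
  + by apply: ideal_sub => //; [apply: ideal_mulr => //|apply: ideal_mull => //]; apply: G3x;
      apply: (subsetP sV').
  + exact: G3x.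
  + exact: G3y.
  + by apply: idl_gen; left; exists t => //; rewrite setU1r.
Qed.

(* Quantifying over all ideals [B] in the remaining variables replaces the
   Kuenneth formula for disjoint unions. *)
Definition regbound e V (f : nat) := forall B r, homG B -> gfree (vset V) B ->
  regle (idl B) r -> regle (idl (gU (gE e V) B)) (r + f)%N.

Lemma regbound_edgeless e V : {in V &, forall i j, ~~ e i j} -> regbound e V 0.
Proof.
move=> ne B r _ _; rewrite addn0; apply: regle_ext; apply: idl_eq => g.
  by move=> Bg; apply: idl_gen; right.
case=> [[i [j [iV jV eij _]]]|]; last exact: idl_gen.
by move: (ne i j iV jV); rewrite eij.
Qed.

Lemma regbound_complete e V : {in V &, forall i j, i != j -> e i j} -> regbound e V 1.
Proof.
move=> ce B r hB fB rB; rewrite addn1; apply: regle_ext (regle_gK hB fB rB).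
apply: idl_eq => g [|Bg]; try by apply: idl_gen; right.
  move=> [i [j [iV jV ->]]]; have [->|nij] := eqVneq i j; first by rewrite fmii; apply: idl0.
  by apply: idl_gen; left; exists i, j; split=> //; apply: ce.
by move=> /gE_gK Kg; apply: idl_gen; left.
Qed.

(** The bound for [V1] is applied with the ideal of [V2] absorbed into [B]. *)
Lemma regbound_disjoint e V1 V2 f1 f2 : [disjoint V1 & V2] ->
  {in V1 & V2, forall i j, ~~ e i j && ~~ e j i} ->
  regbound e V1 f1 -> regbound e V2 f2 -> regbound e (V1 :|: V2) (f1 + f2).
Proof.
move=> dis ne b1 b2 B r hB fB rB.
have := b1 (gU (gE e V2) B) (r + f2)%N; rewrite -addnA [(f2 + f1)%N]addnC => b.
have : regle (idl (gU (gE e V1) (gU (gE e V2) B))) (r + (f1 + f2)).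
  apply: b.
  - by apply: homG_U => //; apply: homG_gE.
  - apply: gfree_U; last by apply: gfree_sub fB; apply: vsetS; apply: subsetUl.
    by apply: gfree_gE; apply: vset_disjoint.
  - by apply: b2 => //; apply: gfree_sub fB; apply: vsetS; apply: subsetUr.
apply: regle_ext; apply: idl_eq => g.
  by case=> [|[|Bg]]; [move=> [i [j [iV jV eij ->]]]|move=> [i [j [iV jV eij ->]]]|];
    apply: idl_gen; [left|left|by right]; exists i, j; rewrite !inE ?iV ?jV ?orbT.
case=> [[i [j [/setUP iV /setUP jV eij ->]]]|Bg]; apply: idl_gen; last by right; right.
case: iV jV => [i1|i2] [j1|j2].
- by left; exists i, j.
- by have := ne i j i1 j2; rewrite eij.
- by have := ne j i j1 i2; rewrite eij andbF.
- by right; left; exists i, j.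
Qed.

(** For [w] in [V2] the identity [x_w f_ij = x_i f_wj - x_j f_wi], and likewise with [y], expresses
    multiples of a possibly missing edge of [V1] through the edges of the join. *)
Lemma gV_mul_fm e V1 V2 B c i j : {in V1 & V2, forall a b, e a b && e b a} ->
  i \in V1 -> j \in V1 -> idl (gV V2) c -> idl (gU (gE e (V1 :|: V2)) B) (c * fm i j).
Proof.
move=> cross i1 j1; set J := idl (gU _ B); have idJ : ideal J by apply: idl_ideal.
have Jf w a : w \in V2 -> a \in V1 -> J (fm w a).
  move=> w2 a1; apply: idl_gen; left; exists w, a.
  by rewrite !inE w2 a1 orbT; split=> //; have /andP[] := cross a w a1 w2.
elim=> [|a g c' [t /vsetP[w w2 tw] ->] _ IH]; first by rewrite mul0r; case: idJ.
rewrite mulrDl -mulrA; apply: ideal_add => //; apply: ideal_mull => //.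
case: tw => ->.
  rewrite (_ : _ * _ = x i * fm w j - x j * fm w i); last by rewrite /fm /x; ring.
  by apply: ideal_sub => //; apply: ideal_mull => //; apply: Jf.
rewrite (_ : _ * _ = y i * fm w j - y j * fm w i); last by rewrite /fm /y; ring.
by apply: ideal_sub => //; apply: ideal_mull => //; apply: Jf.
Qed.

Lemma sub_kill_gK e V1 V2 B a : {in V1 & V2, forall i j, e i j && e j i} ->
  [disjoint V1 & V2] -> idl (gK V1) a ->
  idl (gU (gE e (V1 :|: V2)) B) (a - kill (vset V2) a).
Proof.
move=> cross dis; set J := idl (gU _ B); have idJ : ideal J by apply: idl_ideal.
elim=> [|c g a' [i [j [i1 j1 ->]]] _ IH]; first by rewrite rmorph0 subrr; case: idJ.
have Ek : kill (vset V2) (c * fm i j + a') = kill (vset V2) c * fm i j + kill (vset V2) a'.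
  rewrite rmorphD rmorphM /= [kill _ (fm i j)](@gfree_gK (vset V2) V1) //; last by exists i, j.
  by apply: vset_disjoint; rewrite disjoint_sym.
rewrite Ek (_ : _ - _ = (c - kill (vset V2) c) * fm i j + (a' - kill (vset V2) a')); last by ring.
by apply: ideal_add => //; apply: (@gV_mul_fm e V1 V2 B) => //; apply: sub_kill.
Qed.

(** Each set of generators is swallowed by the variables of its own side. [G1] and [G2] stay general
    to serve both [gE] and [gK]. *)
Lemma isum_gV V1 V2 G1 G2 B f : (forall g, G1 g -> idl (gV V1) g) ->
  (forall g, G2 g -> idl (gV V2) g) ->
  isum (idl (gU (gV V1) (gU G2 B))) (idl (gU (gV V2) (gU G1 B))) f <->
  idl (gU (gV (V1 :|: V2)) B) f.
Proof.
move=> G1V G2V; rewrite -idl_gU; move: f.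
have sV V g : V \subset V1 :|: V2 -> idl (gV V) g -> idl (gU (gV (V1 :|: V2)) B) g.
  move=> sV Vg; apply: idl_Ul; apply: idl_sub Vg => h [t tV ->]; apply: idl_gen.
  by exists t => //; apply: (subsetP (vsetS sV)).
have s1 := subsetUl V1 V2; have s2 := subsetUr V1 V2.
apply: idl_eq => g.
  case=> [[Vg|[Gg|Bg]]|[Vg|[Gg|Bg]]]; try by apply: idl_gen; right.
  - by apply: sV s1 _; apply: idl_gen.
  - by apply: sV s2 _; apply: G2V.
  - by apply: sV s2 _; apply: idl_gen.
  - by apply: sV s1 _; apply: G1V.
case=> [[t /vsetP[i /setUP[i1|i2] ti] ->]|Bg]; apply: idl_gen.
- by left; left; exists t => //; case: ti => ->; rewrite ?lshift_vset ?rshift_vset.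
- by right; left; exists t => //; case: ti => ->; rewrite ?lshift_vset ?rshift_vset.
- by left; right; right.
Qed.

Lemma gE_gV e V g : gE e V g -> idl (gV V) g.
Proof. by move=> /gE_gK /gK_gV. Qed.

Lemma gE_join_gV e V1 V2 B f : idl (gU (gE e (V1 :|: V2)) B) f ->
  idl (gU (gV V2) (gU (gE e V1) B)) f.
Proof.
apply: idl_sub => g [[i [j [iV jV eij ->]]]|Bg]; last by apply: idl_gen; right; right.
case/setUP: iV => [i1|i2]; last by apply: idl_Ul; apply: gV_fml.
case/setUP: jV => [j1|j2]; last by apply: idl_Ul; apply: gV_fmr.
by apply: idl_gen; right; left; exists i, j.
Qed.

(** By [sub_kill_gK] the element may be replaced by its restriction to [V2 = 0]; this restriction
    turns the second membership into one in the ideal of [V1] and [B]. *)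
Lemma gE_join_gK e V1 V2 B a : {in V1 & V2, forall i j, e i j && e j i} ->
  [disjoint V1 & V2] -> gfree (vset V2) B -> idl (gK V1) a ->
  idl (gU (gV V2) (gU (gE e V1) B)) a -> idl (gU (gE e (V1 :|: V2)) B) a.
Proof.
move=> cross dis fB Ka Aa; rewrite -(subrK (kill (vset V2) a) a).
apply: ideal_add (idl_ideal _) _ _; first exact: sub_kill_gK.
have : idl (gU (gE e V1) B) (kill (vset V2) a).
  apply: idl_kill_gX Aa; apply: gfree_U => //.
  by apply: gfree_gE; apply: vset_disjoint; rewrite disjoint_sym.
apply: idl_sub => g [[i [j [i1 j1 eij ->]]]|Bg]; apply: idl_gen; last by right.
by left; exists i, j; rewrite !inE i1 j1.
Qed.

(** Cross edges lie in the ideal, so modulo it an element of [J_(K_V)] is [a1 + a2] with [ai] in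
    [J_(K_Vi)]. As [a2] is in [(V2)], the second membership of [f] passes to [a1], which
    [gE_join_gK] then handles; [a2] is symmetric. *)
Lemma gE_joinE e V1 V2 B f : {in V1 & V2, forall i j, e i j && e j i} ->
  [disjoint V1 & V2] -> gfree (vset (V1 :|: V2)) B ->
  iint (iint (idl (gU (gV V1) (gU (gE e V2) B))) (idl (gU (gV V2) (gU (gE e V1) B))))
       (idl (gU (gK (V1 :|: V2)) B)) f <-> idl (gU (gE e (V1 :|: V2)) B) f.
Proof.
move=> cross dis fB; set J := idl (gU (gE e _) B); have idJ : ideal J by apply: idl_ideal.
have cross' : {in V2 & V1, forall i j, e i j && e j i}.
  by move=> i j i2 j1; rewrite andbC; apply: cross.
have JA12 g : J g -> idl (gU (gV V1) (gU (gE e V2) B)) g.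
  by rewrite /J setUC; apply: gE_join_gV.
have JA21 g : J g -> idl (gU (gV V2) (gU (gE e V1) B)) g by apply: gE_join_gV.
split=> [[[A12 A21] Lf]|Jf]; last first.
  split; first by split; [apply: JA12|apply: JA21].
  apply: idl_sub Jf => g [/gE_gK Kg|Bg]; apply: idl_gen; by [left|right].
have idK V := idl_ideal (gK V).
have : isum J (isum (idl (gK V1)) (idl (gK V2))) f.
  have idS : ideal (isum (idl (gK V1)) (idl (gK V2))) by apply: isum_ideal.
  apply: idl_min Lf => [|g]; first exact: isum_ideal.
  case=> [[i [j [iV jV ->]]]|Bg]; last by apply: isum_l => //; apply: idl_gen; right.
  have cr i' j' : i' \in V1 -> j' \in V2 -> J (fm i' j').
    move=> i1 j2; apply: idl_gen; left; exists i', j'; rewrite !inE i1 j2 orbT; split=> //.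
    by have /andP[] := cross i' j' i1 j2.
  case/setUP: iV => [i1|i2]; case/setUP: jV => [j1|j2].
  - by apply: isum_r => //; apply: isum_l => //; apply: idl_gen; exists i, j.
  - by apply: isum_l => //; apply: cr.
  - by apply: isum_l => //; rewrite fmC; apply: ideal_opp => //; apply: cr.
  - by apply: isum_r => //; apply: isum_r => //; apply: idl_gen; exists i, j.
move=> [g [_ [Jg [a1 [a2 [K1 K2 ->]]] Ef]]].
have A12a1 : idl (gU (gV V1) (gU (gE e V2) B)) a1.
  by apply: idl_Ul; apply: idl_sub K1; apply: gK_gV.
have A21a2 : idl (gU (gV V2) (gU (gE e V1) B)) a2.
  by apply: idl_Ul; apply: idl_sub K2; apply: gK_gV.
rewrite Ef; do 2![apply: ideal_add => //].
  apply: gE_join_gK => //; first by apply: gfree_sub fB; apply: vsetS; apply: subsetUr.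
  rewrite (_ : a1 = f - g - a2); last by rewrite Ef; ring.
  by do 2![apply: ideal_sub (idl_ideal _) _ _ => //]; apply: JA21.
rewrite /J setUC; apply: gE_join_gK => //.
- by rewrite disjoint_sym.
- by apply: gfree_sub fB; apply: vsetS; apply: subsetUl.
rewrite (_ : a2 = f - g - a1); last by rewrite Ef; ring.
by do 2![apply: ideal_sub (idl_ideal _) _ _ => //]; apply: JA12.
Qed.

(** For the harder inclusion write [f = a + q + b] with [a] in [(V1)], [q] in [J_(K_V2)] and [b] in
    [B]. Setting the variables of [V2] to 0 sends [a] into [J_(K_V1) + B], and [a] minus its
    restriction lies in both [(V1)] and [(V2)]. *)
Lemma gK_joinE e V1 V2 B f : [disjoint V1 & V2] -> gfree (vset (V1 :|: V2)) B ->
  isum (iint (idl (gU (gV V1) (gU (gE e V2) B))) (idl (gU (gV V2) (gU (gE e V1) B))))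
       (idl (gU (gK (V1 :|: V2)) B)) f <->
  iint (idl (gU (gV V1) (gU (gK V2) B))) (idl (gU (gV V2) (gU (gK V1) B))) f.
Proof.
move=> dis fB; set L := idl (gU (gK _) B); have idL : ideal L by apply: idl_ideal.
split.
  have sub V V' g : idl (gU (gV V) (gU (gE e V') B)) g -> idl (gU (gV V) (gU (gK V') B)) g.
    apply: idl_sub => h [Vh|[/gE_gK Kh|Bh]]; apply: idl_gen; by [left|right; left|right; right].
  have Lsub V V' g : (forall i, i \in V1 :|: V2 -> (i \in V) || (i \in V')) ->
      L g -> idl (gU (gV V) (gU (gK V') B)) g.
    move=> sV; apply: idl_sub => h [[i [j [/sV/orP iV /sV/orP jV ->]]]|Bh].
      case: iV => [iV|iV]; first by apply: idl_Ul; apply: gV_fml.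
      case: jV => [jV|jV]; first by apply: idl_Ul; apply: gV_fmr.
      by apply: idl_gen; right; left; exists i, j.
    by apply: idl_gen; right; right.
  move=> [a [b [[A12 A21] Lb ->]]]; split; apply: ideal_add (idl_ideal _) _ _.
  - exact: sub.
  - by apply: Lsub => // i; rewrite inE.
  - exact: sub.
  - by apply: Lsub => // i; rewrite inE orbC.
move=> [/idl_gU[a [_ [Va /idl_gU[q [b [Kq Bb ->]]] Ef]]] A21].
have Lq : L q.
  apply: idl_Ul; apply: idl_sub Kq => g [i [j [iV jV ->]]]; apply: idl_gen.
  by exists i, j; rewrite !inE iV jV !orbT.
have Lb : L b by apply: idl_Ur.
have A21a : idl (gU (gV V2) (gU (gK V1) B)) a.
  have idA := idl_ideal (gU (gV V2) (gU (gK V1) B)).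
  rewrite (_ : a = f - q - b); last by rewrite Ef; ring.
  apply: ideal_sub => //; first apply: ideal_sub => //.
    by apply: idl_Ul; apply: idl_sub Kq; apply: gK_gV.
  by apply: idl_Ur; apply: idl_Ur.
have fB2 : gfree (vset V2) B by apply: gfree_sub fB; apply: vsetS; apply: subsetUr.
have dis' : [disjoint vset V2 & vset V1] by apply: vset_disjoint; rewrite disjoint_sym.
have Lka : L (kill (vset V2) a).
  have : idl (gU (gK V1) B) (kill (vset V2) a).
    by apply: idl_kill_gX A21a; apply: gfree_U => //; apply: gfree_gK.
  apply: idl_sub => g [[i [j [iV jV ->]]]|Bg]; apply: idl_gen; last by right.
  by left; exists i, j; rewrite !inE iV jV.
have Vka : idl (gV V1) (kill (vset V2) a) by apply: idl_kill Va; apply: gfree_gX.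
exists (a - kill (vset V2) a), (kill (vset V2) a + q + b); split; last by rewrite Ef; ring.
  split; apply: idl_Ul; last exact: sub_kill.
  by apply: ideal_sub (idl_ideal _) _ _.
by do 2![apply: ideal_add => //].
Qed.

Lemma regbound_join e V1 V2 f1 f2 : {in V1 & V2, forall i j, e i j && e j i} ->
  [disjoint V1 & V2] -> regbound e V1 f1 -> regbound e V2 f2 ->
  regbound e (V1 :|: V2) (maxn 2 (maxn f1 f2)).
Proof.
move=> cross dis b1 b2 B r hB fB rB.
have hV (V : {set 'I_n}) : homG (gU (gV V) B) by apply: homG_U => //; apply: homG_gV.
have fB1 : gfree (vset V1) B by apply: gfree_sub fB; apply: vsetS; apply: subsetUl.
have fB2 : gfree (vset V2) B by apply: gfree_sub fB; apply: vsetS; apply: subsetUr.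
have dis' : [disjoint V2 & V1] by rewrite disjoint_sym.
have fV V V' : [disjoint V & V'] -> gfree (vset V) B -> gfree (vset V) (gU (gV V') B).
  by move=> d fBV; apply: gfree_U => //; apply: gfree_gX; apply: vset_disjoint.
have rV V : gfree (vset V) B -> regle (idl (gU (gV V) B)) r.
  by move=> fBV; apply: regle_gX.
have hE V V' : hideal (idl (gU (gV V) (gU (gE e V') B))).
  by apply: idl_hideal; apply: homG_U; [apply: homG_gV|apply: homG_U => //; apply: homG_gE].
have hK V V' : hideal (idl (gU (gV V) (gU (gK V') B))).
  by apply: idl_hideal; apply: homG_U; [apply: homG_gV|apply: homG_U => //; apply: homG_gK].
have hL : hideal (idl (gU (gK (V1 :|: V2)) B)).
  by apply: idl_hideal; apply: homG_U => //; apply: homG_gK.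
(* The outer [regle_int] lowers the bound for the sum to [r + F + 1], which still leaves the 1 that
   this sum requires. *)
set m := maxn 2 _; have [F Em] : exists F, m = F.+2 by exists m.-2; rewrite /m; lia.
rewrite Em !addnS; apply: (regle_ext (fun f => gE_joinE f cross dis fB)).
apply: regle_int => //; first exact: iint_hideal.
- apply: regle_int => //.
  + apply: regle_ext (fun f => idl_gUCA _ _ _ f) _.
    apply: (@regle_mono _ _ _ (r + f2)); first by move: Em; rewrite /m; lia.
    by apply: b2 => //; [apply: fV|apply: rV].
  + apply: regle_ext (fun f => idl_gUCA _ _ _ f) _.
    apply: (@regle_mono _ _ _ (r + f1)); first by move: Em; rewrite /m; lia.
    by apply: b1 => //; [apply: fV|apply: rV].
  + apply: (@regle_mono _ _ _ r); first by lia.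
    apply: (regle_ext (fun f => iff_sym (isum_gV B f (@gE_gV e V1) (@gE_gV e V2)))).
    exact: rV.
- by apply: (@regle_mono _ _ _ r.+1); [lia|apply: regle_gK].
apply: (regle_ext (fun f => iff_sym (gK_joinE e f dis fB))).
apply: (@regle_mono _ _ _ r.+1); first by lia.
apply: regle_int => //.
- apply: regle_ext (fun f => idl_gUCA _ _ _ f) _.
  by apply: regle_gK => //; [apply: fV|apply: rV].
- apply: regle_ext (fun f => idl_gUCA _ _ _ f) _.
  by apply: regle_gK => //; [apply: fV|apply: rV].
apply: (regle_ext (fun f => iff_sym (isum_gV B f (@gK_gV V1) (@gK_gV V2)))).
exact: rV.
Qed.

End BinomialIdeals.

(** * Cographs *)

Section Cuts.

Variable T : finType.
Implicit Types (e : rel T) (A B V W : {set T}).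

(** For symmetric irreflexive [e] these adjacencies force the four vertices to be distinct. *)
Definition P4free e := forall a b c d,
  e a b -> e b c -> e c d -> ~~ e a c -> ~~ e a d -> ~~ e b d -> False.

Lemma cograph_P4free e : ssrbool.symmetric e -> irreflexive e -> cograph e -> P4free e.
Proof.
move=> sym irr cog a b c d ab bc cd /negbTE nac /negbTE nad /negbTE nbd; apply: cog.
have ba : e b a by rewrite sym.
have cb : e c b by rewrite sym.
have dc : e d c by rewrite sym.
have nca : e c a = false by rewrite sym.
have nda : e d a = false by rewrite sym.
have ndb : e d b = false by rewrite sym.
exists (tnth [tuple a; b; c; d]).
have adj i j : e (tnth [tuple a; b; c; d] i) (tnth [tuple a; b; c; d] j) =
    (i.+1 == j :> nat) || (j.+1 == i :> nat).
  case: i => [[|[|[|[|i]]]] hi] //; case: j => [[|[|[|[|j]]]] hj] //;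
    rewrite !(tnth_nth a) /= ?irr //.
split=> // i j Eij.
(* No two vertices of a path on 4 vertices have the same neighbours, so equal images come from equal
   indices. *)
have E (l : 'I_4) : ((i.+1 == l :> nat) || (l.+1 == i :> nat)) = ((j.+1 == l :> nat) || (l.+1 == j :> nat)).
  by rewrite -(adj i l) -(adj j l) Eij.
apply/val_inj => /=; move: (E ord0) (E (inord 1)) (E (inord 2)) (E ord_max).
rewrite /= !inordK //; case: (i) => [[|[|[|[|i']]]] hi] //; case: (j) => [[|[|[|[|j']]]] hj] //.
Qed.

Definition nonadj e : rel T := fun i j => (i != j) && ~~ e i j.

Lemma nonadj_sym e : ssrbool.symmetric e -> ssrbool.symmetric (nonadj e).
Proof. by move=> sym i j; rewrite /nonadj eq_sym sym. Qed.

(** The path on 4 vertices is self-complementary: the complement of [a b c d] is the path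
    [c a d b]. *)
Lemma nonadj_P4free e : ssrbool.symmetric e -> P4free e -> P4free (nonadj e).
Proof.
move=> sym P4 a b c d ab bc cd nac nad nbd.
have adj i j : ~~ nonadj e i j -> i != j -> e i j.
  by rewrite /nonadj negb_and !negbK => /orP[->|].
have nadj i j : nonadj e i j -> ~~ e i j by case/andP.
apply: (P4 c a d b).
- rewrite sym; apply: adj nac _; apply: contraNneq nad => ->; exact: cd.
- apply: adj nad _; apply: contraNneq nbd => <-; by rewrite nonadj_sym.
- rewrite sym; apply: adj nbd _; apply: contraNneq nad => <-; exact: ab.
- exact: nadj.
- by rewrite sym nadj.
- exact: nadj.
Qed.

Definition anticomplete e A B := {in A & B, forall i j, ~~ e i j}.

Lemma anticomplete_sym e A B : ssrbool.symmetric e -> anticomplete e A B -> anticomplete e B A.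
Proof. by move=> sym h i j iB jA; rewrite sym h. Qed.

Definition has_cut e W := exists C D, [/\ C != set0, D != set0, [disjoint C & D],
  C :|: D = W & anticomplete e C D \/ anticomplete (nonadj e) C D].

(** If [v] is adjacent to everything, it is joined to the rest. Otherwise it misses some [u], say in
    [A]. If it has no neighbour in [B], then [B] splits off; if it has a neighbour [w] there, the
    non-neighbours of [v] in [A] split off, since an edge from such a [b] to a neighbour [a] of [v]
    in [A] would give the induced path [b a v w]. *)
Lemma has_cutS e A B v : ssrbool.symmetric e -> P4free e ->
  A != set0 -> B != set0 -> [disjoint A & B] -> v \notin A :|: B ->
  anticomplete e A B -> has_cut e (v |: (A :|: B)).
Proof.
move=> sym P4.
have main A' B' : A' != set0 -> B' != set0 -> [disjoint A' & B'] -> v \notin A' :|: B' ->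
    anticomplete e A' B' -> (exists2 u, u \in A' & ~~ e v u) -> has_cut e (v |: (A' :|: B')).
  move=> A0 B0 dis; rewrite inE negb_or => /andP[vA vB] ac [u uA vu].
  have [vB0|/forallPn[w]] := boolP [forall w, (w \in B') ==> ~~ e v w]; last first.
    rewrite negb_imply negbK => /andP[wB vw].
    pose A2 := [set a in A' | ~~ e v a].
    have uA2 : u \in A2 by rewrite inE uA.
    have sA2 : A2 \subset A' by apply/subsetP => a; rewrite inE => /andP[].
    exists A2, (v |: (A' :\: A2 :|: B')); split.
    - by apply/set0Pn; exists u.
    - by apply/set0Pn; exists v; rewrite setU11.
    - rewrite -setI_eq0; apply/eqP/setP => a; rewrite !inE.
      case: eqP => [->|_]; first by rewrite (negbTE vA).
      by case aA: (a \in A') => //=; rewrite (disjointFr dis aA); case: (e v a).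
    - apply/setP => a; rewrite !inE; case: (a \in A'); case: (e v a); case: (a \in B');
        by rewrite ?orbT ?orbF.
    left=> b a bA2 /setU1P[->|/setUP[|aB]].
    - by move: bA2; rewrite inE sym => /andP[].
    - rewrite !inE => /andP[na aA]; rewrite aA /= negbK in na.
      apply/negP => ba; have [bA vb] : b \in A' /\ ~~ e v b by move: bA2; rewrite inE => /andP.
      apply: (P4 b a v w) => //; first by rewrite sym.
      + by rewrite sym.
      + exact: ac.
      + exact: ac.
    - by apply: ac => //; apply: (subsetP sA2).
  exists B', (v |: A'); split=> //.
  - by apply/set0Pn; exists v; rewrite setU11.
  - rewrite disjoint_sym -setI_eq0; apply/eqP/setP => a; rewrite !inE.
    case: eqP => [->|_] /=; first by rewrite (negbTE vB).
    by case aA: (a \in A') => //=; rewrite (disjointFr dis aA).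
  - by rewrite setUC -setUA.
  left=> b a bB /setU1P[->|aA]; last by rewrite sym; apply: ac.
  by rewrite sym; move/forallP/(_ b): vB0; rewrite bB.
move=> A0 B0 dis vAB ac.
have [all_e|/forallPn[u]] := boolP [forall u, (u \in A :|: B) ==> e v u].
  exists [set v], (A :|: B); split=> //.
  - by apply/set0Pn; exists v; rewrite inE.
  - by case/set0Pn: A0 => a aA; apply/set0Pn; exists a; rewrite inE aA.
  - by rewrite disjoints1.
  right=> i j /set1P -> jAB; rewrite /nonadj negb_and negbK.
  by move/forallP/(_ j): all_e; rewrite jAB /= => ->; rewrite orbT.
rewrite negb_imply => /andP[/setUP[uA|uB] vu]; first by apply: main => //; exists u.
rewrite [A :|: B]setUC; apply: main => //.
- by rewrite disjoint_sym.
- by rewrite setUC.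
- exact: anticomplete_sym.
- by exists u.
Qed.

(** A vertex is deleted and the rest is cut by induction; when the rest is a join, [has_cutS] is
    applied in the complement. *)
Lemma P4free_has_cut e W : ssrbool.symmetric e -> irreflexive e -> P4free e ->
  (1 < #|W|)%N -> has_cut e W.
Proof.
move=> sym irr P4; move: {2}#|W| (erefl #|W|) => m; elim: m W => [|m IH] W cW; first by lia.
move=> W1; have /card_gt0P[v vW] : (0 < #|W|)%N by lia.
have cW' : #|W :\ v| = m by have := cardsD1 v W; rewrite vW cW; lia.
have vW' : v \notin W :\ v by rewrite !inE eqxx.
have [m1|m1] := leqP m 1.
  have /card_gt0P[u uW'] : (0 < #|W :\ v|)%N by lia.
  have W'E : W :\ v = [set u].
    by apply/esym/eqP; rewrite eqEcard sub1set uW' cards1; lia.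
  exists [set v], [set u]; split.
  - by apply/set0Pn; exists v; rewrite inE.
  - by apply/set0Pn; exists u; rewrite inE.
  - by rewrite disjoints1 -W'E.
  - by rewrite -W'E setD1K.
  have [evu|nevu] := boolP (e v u); [right|left]; move=> i j /set1P -> /set1P -> //.
  by rewrite /nonadj evu andbF.
have [C [D [C0 D0 dis CD cut]]] : has_cut e (W :\ v) by apply: IH => //; rewrite cW'.
rewrite -CD in vW'; rewrite -(setD1K vW) -CD; case: cut => ac; first exact: has_cutS.
have [|C' [D' [C0' D0' dis' CD' cut]]] := has_cutS (nonadj_sym sym) _ C0 D0 dis vW' ac.
  exact: nonadj_P4free.
exists C', D'; split=> //; case: cut => h; [by right|left] => i j iC jD.
have := h i j iC jD; rewrite /nonadj; case: eqP => [Eij _|_]; last by case: (e i j).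
by rewrite Eij (disjointFl dis' jD) in iC.
Qed.

End Cuts.

(** * Independent sets of disjoint unions and joins *)

Section Counting.

Variable T : finType.
Variable e : rel T.
Hypotheses (e_sym : ssrbool.symmetric e) (e_irr : irreflexive e).
Implicit Types (A B V W : {set T}).

Definition indep_in V A := (A \subset V) && independent e A.
Definition max_indep V := [set A : {set T} | maxset (indep_in V) A].
Definition indep_number V := \max_(A : {set T} | indep_in V A) #|A|.

Lemma independentP A : reflect {in A &, forall i j, ~~ e i j} (independent e A).
Proof.
apply: (iffP forall_inP) => [h i j iA jA|h i iA].
  by have /forall_inP := h i iA; apply.
by apply/forall_inP => j jA; apply: h.
Qed.

Lemma independentS A B : A \subset B -> independent e B -> independent e A.
Proof.
move=> /subsetP sAB /independentP h; apply/independentP => i j iA jA.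
by apply: h; apply: sAB.
Qed.

Lemma independent1 v : independent e [set v].
Proof. by apply/independentP => i j /set1P -> /set1P ->; rewrite e_irr. Qed.

Lemma max_indepP V A : reflect (indep_in V A /\ forall B, indep_in V B -> A \subset B -> B = A)
  (A \in max_indep V).
Proof. by rewrite inE; apply: (iffP maxsetP). Qed.

Lemma max_indep_gt0 V : (0 < #|max_indep V|)%N.
Proof.
have [|A mA _] := @maxset_exists _ (indep_in V) set0.
  by rewrite /indep_in sub0set; apply/independentP => i j; rewrite inE.
by apply/card_gt0P; exists A; rewrite inE.
Qed.

Lemma max_indep_neq0 V A : V != set0 -> A \in max_indep V -> A != set0.
Proof.
case/set0Pn => v vV /max_indepP[_ mA]; apply/eqP => A0.
have : [set v] = A by apply: mA; rewrite ?A0 ?sub0set // /indep_in sub1set vV independent1.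
by rewrite A0 => /setP/(_ v); rewrite !inE eqxx.
Qed.

Lemma indep_number_ge V A : indep_in V A -> (#|A| <= indep_number V)%N.
Proof. by move=> iA; rewrite /indep_number (bigD1 A) //= leq_maxl. Qed.

Lemma indep_number_attained V : exists2 A, indep_in V A & indep_number V = #|A|.
Proof.
have [|A iA E] := @eq_bigmax_cond _ (indep_in V) (fun A => #|A|); last by exists A.
apply/card_gt0P; exists set0; rewrite unfold_in sub0set.
by apply/independentP => i j; rewrite inE.
Qed.

Lemma indep_numberS V W : V \subset W -> (indep_number V <= indep_number W)%N.
Proof.
move=> sVW; apply/bigmax_leqP => A /andP[sA iA]; apply: indep_number_ge.
by rewrite /indep_in (subset_trans sA sVW).
Qed.

Lemma indep_number_gt0 V : V != set0 -> (0 < indep_number V)%N.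
Proof.
case/set0Pn => v vV; rewrite -(cards1 v); apply: indep_number_ge.
by rewrite /indep_in sub1set vV independent1.
Qed.

Lemma indep_number_gt1 V i j : i \in V -> j \in V -> i != j -> ~~ e i j ->
  (1 < indep_number V)%N.
Proof.
move=> iV jV nij eij; rewrite -[2%N]/(true.+1) -nij -cards2; apply: indep_number_ge.
rewrite /indep_in subUset !sub1set iV jV; apply/independentP => a b.
by move=> /set2P[]-> /set2P[]->; rewrite ?e_irr // e_sym.
Qed.

Section Disjoint.

Variables V1 V2 : {set T}.
Hypotheses (dis : [disjoint V1 & V2]).

Lemma setI_disjointl A1 A2 : A1 \subset V1 -> A2 \subset V2 -> (A1 :|: A2) :&: V1 = A1.
Proof.
move=> s1 s2; rewrite setIUl (setIidPl s1); apply/setUidPl.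
rewrite (_ : A2 :&: V1 = set0) ?sub0set //; apply/eqP; rewrite setI_eq0.
by apply: disjointWl s2 _; rewrite disjoint_sym.
Qed.

Lemma setI_disjointr A1 A2 : A1 \subset V1 -> A2 \subset V2 -> (A1 :|: A2) :&: V2 = A2.
Proof.
move=> s1 s2; rewrite setIUl (setIidPl s2) setUC; apply/setUidPl.
rewrite (_ : A1 :&: V2 = set0) ?sub0set //; apply/eqP; rewrite setI_eq0.
exact: disjointWl s1 dis.
Qed.

Lemma indep_in_setI V W A : indep_in W A -> indep_in V (A :&: V).
Proof. by case/andP => _; rewrite /indep_in subsetIr; apply: independentS; apply: subsetIl. Qed.

Section Anticomplete.

Hypothesis ac : anticomplete e V1 V2.

Lemma indep_in_setU A1 A2 : indep_in V1 A1 -> indep_in V2 A2 -> indep_in (V1 :|: V2) (A1 :|: A2).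
Proof.
move=> /andP[s1 /independentP i1] /andP[s2 /independentP i2]; rewrite /indep_in setUSS //.
apply/independentP => i j /setUP[iA|iA] /setUP[jA|jA].
- exact: i1.
- by apply: ac; [apply: (subsetP s1)|apply: (subsetP s2)].
- by rewrite e_sym; apply: ac; [apply: (subsetP s1)|apply: (subsetP s2)].
- exact: i2.
Qed.

Lemma indep_number_anticomplete :
  (indep_number V1 + indep_number V2 <= indep_number (V1 :|: V2))%N.
Proof.
have [A1 iA1 ->] := indep_number_attained V1; have [A2 iA2 ->] := indep_number_attained V2.
apply: leq_trans (indep_number_ge (indep_in_setU iA1 iA2)).
rewrite cardsU (_ : A1 :&: A2 = set0) ?cards0 ?subn0 //; apply/eqP; rewrite setI_eq0.
by case/andP: iA1 => s1 _; case/andP: iA2 => s2 _; apply: disjointWl s1 (disjointWr s2 dis).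
Qed.

(** Union is injective on pairs of maximal sets, as intersecting with [V1] and [V2] recovers them;
    the same intersections show that the union is maximal. *)
Lemma max_indep_anticomplete :
  (#|max_indep V1| * #|max_indep V2| <= #|max_indep (V1 :|: V2)|)%N.
Proof.
rewrite -cardsX -(card_in_imset (f := fun u : {set T} * {set T} => u.1 :|: u.2)).
  apply/subset_leq_card/subsetP => _ /imsetP[[A1 A2] /setXP[/= m1 m2] ->].
  case/max_indepP: m1 => i1 m1; case/max_indepP: m2 => i2 m2.
  apply/max_indepP; split=> [|C iC sC]; first exact: indep_in_setU.
  have [/andP[s1 _] /andP[s2 _] /andP[sCV _]] := And3 i1 i2 iC.
  have := m1 _ (indep_in_setI V1 iC) _; have := m2 _ (indep_in_setI V2 iC) _.
  rewrite !subsetI s1 s2 !andbT !(subset_trans _ sC) ?subsetUl ?subsetUr // => E2 E1.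
  by rewrite -E1 // -E2 // -setIUr; apply/esym/setIidPl.
move=> [A1 A2] [B1 B2] /setXP[/= mA1 mA2] /setXP[/= mB1 mB2] E.
have sub V A : A \in max_indep V -> A \subset V by case/max_indepP => /andP[].
have E1 : A1 = B1.
  by rewrite -(setI_disjointl (sub _ _ mA1) (sub _ _ mA2)) E setI_disjointl ?sub.
have E2 : A2 = B2.
  by rewrite -(setI_disjointr (sub _ _ mA1) (sub _ _ mA2)) E setI_disjointr ?sub.
by rewrite E1 E2.
Qed.

End Anticomplete.

Section Complete.

Hypothesis cc : {in V1 & V2, forall i j, e i j && e j i}.
Hypotheses (V1_neq0 : V1 != set0) (V2_neq0 : V2 != set0).

(** A maximal set of one side is nonempty, so no vertex of the other side can be added and it stays
    maximal; nonemptiness also keeps the two families disjoint. *)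
Lemma max_indep_complete :
  (#|max_indep V1| + #|max_indep V2| <= #|max_indep (V1 :|: V2)|)%N.
Proof.
have main W1 W2 : W1 != set0 -> {in W1 & W2, forall i j, e i j} ->
    max_indep W1 \subset max_indep (W1 :|: W2).
  move=> W0 cW; apply/subsetP => A mA; have /set0Pn[a aA] := max_indep_neq0 W0 mA.
  case/max_indepP: mA => /andP[sA iA] mA; apply/max_indepP; split.
    by rewrite /indep_in iA (subset_trans sA) ?subsetUl.
  move=> B /andP[sB iB] sAB; apply: mA => //; rewrite /indep_in iB andbT.
  apply/subsetP => b bB; have /setUP[//|b2] := subsetP sB b bB.
  have := independentP _ iB a b (subsetP sAB a aA) bB.
  by rewrite cW // (subsetP sA).
have s1 := main V1 V2 V1_neq0 (fun i j i1 j2 => proj1 (andP (cc i1 j2))).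
have s2 := main V2 V1 V2_neq0 (fun i j i2 j1 => proj2 (andP (cc j1 i2))).
rewrite setUC in s2.
apply: leq_trans (subset_leq_card (_ : max_indep V1 :|: max_indep V2 \subset _)); last first.
  by rewrite subUset s1.
rewrite cardsU (_ : _ :&: _ = set0) ?cards0 ?subn0 //; apply/setP => A; rewrite !in_set0.
apply/negP => /setIP[m1 m2]; have /set0Pn[a aA] := max_indep_neq0 V1_neq0 m1.
case/max_indepP: m1 => /andP[/subsetP/(_ a aA) a1 _] _.
case/max_indepP: m2 => /andP[/subsetP/(_ a aA) a2 _] _.
by rewrite (disjointFr dis a1) in a2.
Qed.

End Complete.

End Disjoint.

End Counting.

(** * The recursion over cuts and the final bound *)

Section Main.

Variables (k : fieldType) (n : nat) (e : rel 'I_n).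
Hypotheses (e_sym : ssrbool.symmetric e) (e_irr : irreflexive e) (e_P4 : P4free e).

(** The last clause serves disjoint unions, where [f1 + f2] must stay below a product: if both [f]
    are nonzero, both factors are at least 2, and if one is 0, the product still dominates the other
    factor. *)
Lemma regbound_cograph V : V != set0 -> exists f,
  [/\ regbound k e V f, (f <= #|max_indep e V|)%N, (f <= indep_number e V)%N &
      f = 0%N \/ (2 <= #|max_indep e V|)%N].
Proof.
move: {2}#|V| (leqnn #|V|) => m; elim: m V => [|m IH] V cV V0.
  by move: V0; rewrite -card_gt0; lia.
have [c1|c2] := leqP #|V| 1.
  have /cards1P[v ->] : #|V| == 1%N by rewrite eqn_leq c1 card_gt0.
  exists 0%N; split=> //; last by left.
  by apply: regbound_edgeless => i j /set1P -> /set1P ->; rewrite e_irr.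
have [C [D [C0 D0 dis CD cut]]] := P4free_has_cut e_sym e_irr e_P4 c2.
have cCD : (#|C| + #|D| = #|V|)%N.
  by rewrite -CD cardsU (_ : C :&: D = set0) ?cards0 ?subn0 //; apply/eqP; rewrite setI_eq0.
have cC : (0 < #|C|)%N by rewrite card_gt0.
have cD : (0 < #|D|)%N by rewrite card_gt0.
have lC : (#|C| <= m)%N by move: cV; rewrite -cCD; lia.
have lD : (#|D| <= m)%N by move: cV; rewrite -cCD; lia.
have [f1 [b1 s1 a1 z1]] := IH C lC C0; have [f2 [b2 s2 a2 z2]] := IH D lD D0.
have p1 := max_indep_gt0 e C; have p2 := max_indep_gt0 e D.
case: cut => [ac|cc].
  have sV := max_indep_anticomplete e_sym dis ac.
  have aV := indep_number_anticomplete e_sym dis ac.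
  rewrite CD in sV aV; exists (f1 + f2)%N; split.
  - rewrite -CD; apply: regbound_disjoint => // i j iC jD.
    by rewrite [e j i]e_sym ac.
  - by case: z1 z2 => [->|z1] [->|z2]; nia.
  - by lia.
  - by case: z1 z2 => [->|z1] [->|z2]; [left|right; nia|right; nia|right; nia].
have cc' : {in C & D, forall i j, e i j && e j i}.
  move=> i j iC jD; rewrite [e j i]e_sym andbb; have := cc i j iC jD.
  rewrite /nonadj negb_and !negbK => /orP[/eqP Eij|//].
  by rewrite -Eij (disjointFr dis iC) in jD.
have sV := max_indep_complete e_irr dis cc' C0 D0.
have aV1 : (indep_number e C <= indep_number e V)%N by rewrite -CD; apply/indep_numberS/subsetUl.
have aV2 : (indep_number e D <= indep_number e V)%N by rewrite -CD; apply/indep_numberS/subsetUr.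
have a1V := indep_number_gt0 e_irr V0.
rewrite CD in sV.
(* A complete graph has independence number 1, which the value 2 of the join bound would exceed. *)
have [/forall_inP h|] := boolP [forall i in V, [forall j in V, (i != j) ==> e i j]].
  exists 1%N; split; [|lia|lia|right; lia].
  by apply: regbound_complete => i j iV jV; have /forall_inP/(_ j jV)/implyP := h i iV; apply.
rewrite negb_forall_in => /exists_inP[i iV]; rewrite negb_forall_in => /exists_inP[j jV].
rewrite negb_imply => /andP[nij eij].
have aV := indep_number_gt1 e_sym e_irr iV jV nij eij.
exists (maxn 2 (maxn f1 f2)); split; [|lia|lia|right; lia].
by rewrite -CD; apply: regbound_join.
Qed.

Lemma binomial_edge_idealE f :
  binomial_edge_ideal e f <-> idl (gU (gE e setT) (fun _ : {mpoly k[n + n]} => False)) f.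
Proof.
split=> [[c ->]|].
  have idI := idl_ideal (gU (gE e setT) (fun _ : {mpoly k[n + n]} => False)).
  do 2!apply: ideal_sum => // ? ?; apply: ideal_mull => //; apply: idl_gen; left.
  by do 2!eexists; split; last reflexivity.
elim=> [|c g f' [[i [j [_ _ eij ->]]]|//] _ [c' ->]].
  by exists (fun _ _ => 0); rewrite big1 // => i _; rewrite big1 // => j _; rewrite mul0r.
exists (fun a b => (if (a == i) && (b == j) then c else 0) + c' a b).
have -> : c * fm k i j = \sum_a \sum_(b | e a b)
    (if (a == i) && (b == j) then c else 0) * (xvar k a * yvar k b - yvar k a * xvar k b).
  rewrite (bigD1 i) //= [X in _ + X]big1 ?addr0 => [|a /negbTE na]; last first.
    by rewrite big1 // => b _; rewrite na mul0r.
  rewrite (bigD1 j) //= !eqxx /= [X in _ + X]big1 ?addr0 // => b /andP[_ /negbTE nb].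
  by rewrite nb mul0r.
rewrite -big_split /=; apply: eq_bigr => a _; rewrite -big_split /=; apply: eq_bigr => b _.
by rewrite mulrDl.
Qed.

End Main.

Theorem theorem2p12 (k : fieldType) (n : nat) (e : rel 'I_n)
    (n_gt0 : (0 < n)%N) (e_sym : ssrbool.symmetric e) (e_irr : irreflexive e)
    (e_cograph : cograph e) :
  exists r : int,
    regularity (@binomial_edge_ideal k n e) r /\
    r <= (minn (num_max_independent e) (independence_number e))%:Z.
Proof.
have P4 := cograph_P4free e_sym e_irr e_cograph.
have T0 : [set: 'I_n] != set0 by apply/set0Pn; exists (Ordinal n_gt0).
have [f [bf fs fa _]] := regbound_cograph k e_sym e_irr P4 T0.
have eqT A : indep_in e setT A = independent e A by rewrite /indep_in subsetT.
have sE : num_max_independent e = #|max_indep e setT|.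
  apply: eq_card => A; rewrite !inE; apply/maxsetP/maxsetP => -[iA mA]; split=> [|B].
  - by rewrite eqT.
  - by rewrite eqT; apply: mA.
  - by rewrite -eqT.
  - by rewrite -eqT; apply: mA.
have aE : independence_number e = indep_number e setT by apply: eq_bigl => A; rewrite eqT.
set I := @binomial_edge_ideal k n e.
pose G := gU (@gE k n e setT) (fun _ => False).
have hG : homG G by apply: homG_U; [apply: homG_gE|].
have IG g : idl G g <-> I g by rewrite /I binomial_edge_idealE.
have hI : hideal I.
  have [[h0 hD hM] hc] := idl_hideal hG; split; first split.
  - exact/IG.
  - by move=> g h /IG ? /IG ?; apply/IG/hD.
  - by move=> c g /IG ?; apply/IG/hM.
  - by move=> d g /IG ?; apply/IG/hc.
(* The recursion starts from [B = 0], whose bound is 0. *)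
have rI : regle I f by apply: (regle_ext IG); apply: (bf _ 0%N) => //; apply: regle0.
have [|rho [reg le]] := regularity_le hI rI; last first.
  by exists rho; split=> //; apply: le_trans le _; rewrite lez_nat leq_min sE aE fs fa.
(* The generators have degree 2, so no element of the ideal has a constant term. *)
move=> g /IG; elim=> [|c h g' [[i [j [_ _ _ ->]]]|//] _ IH]; first by rewrite mcoeff0.
have h0 := homog_mcoeff0 (@fm_homog k n i j) isT.
by rewrite mcoeffD IH addr0 (rmorphM (mcoeff 0%MM)) /= h0 mulr0.
Qed.
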